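(* Let $n\ge1$, $\boldsymbol a\in\{0,1\}^{n-1}$, $\vec\sigma\in\{0,1\}^n$, and let $\widetilde{\mathcal{P}}_{\boldsymbol a}(\vec\sigma)=\mathcal{P}_{\boldsymbol a}(\vec\sigma)\cup\mathcal{P}_{\boldsymbol a}(\vec\sigma^* )$, a set of $2^{n+1}$ points. With $L=\sum_{i=1}^{n-1}a_i(1-2\sigma_i)$ we have $$\bigl(2^{n+1}L_2(\widetilde{\mathcal{P}}_{\boldsymbol a}(\vec\sigma))\bigr)^2=\frac n{24}+\frac{11}8+\frac1{2^n}-\frac1{9\cdot2^{2n+1}}-\frac{(-1)^{\sigma_n}}{2^{n+2}}L.$$ Hence there is a constant $C>0$ such that $L_2(\widetilde{\mathcal{P}}_{\boldsymbol a}(\vec\sigma))\le C\sqrt{\log 2^{n+1}}/2^{n+1}$ for all $n\ge1$, all $\boldsymbol a\in\{0,1\}^{n-1}$ and all $\vec\sigma\in\{0,1\}^n$.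
   Context: $\oplus$ denotes addition modulo 2. For an integer $n\ge1$, $\boldsymbol{a}=(a_1,\dots,a_{n-1})\in\{0,1\}^{n-1}$ and $\vec{\sigma}=(\sigma_1,\dots,\sigma_n)\in\{0,1\}^n$, let $\mathcal{P}_{\boldsymbol{a}}(\vec{\sigma})\subset[0,1)^2$ be the set of the $2^n$ points $\bigl(\frac{t_n}{2}+\frac{t_{n-1}}{4}+\dots+\frac{t_1}{2^n},\ \frac{b_1}{2}+\dots+\frac{b_n}{2^n}\bigr)$, where $(t_1,\dots,t_n)$ ranges over $\{0,1\}^n$, $b_k=t_k\oplus a_kt_n\oplus\sigma_k$ for $1\le k\le n-1$ and $b_n=t_n\oplus\sigma_n$. Let $\vec\sigma^*=(\sigma_1\oplus1,\dots,\sigma_n\oplus1)$. For an $N$-point set $\mathcal{P}\subset[0,1)^2$ the discrepancy function is $\Delta(\boldsymbol{t},\mathcal{P})=\frac1N\#\{\boldsymbol{z}\in\mathcal{P}:\boldsymbol{z}\in[0,t_1)\times[0,t_2)\}-t_1t_2$ for $\boldsymbol{t}\in[0,1]^2$, and $L_2(\mathcal{P})=\bigl(\int_{[0,1]^2}\Delta(\boldsymbol{t},\mathcal{P})^2\,d\boldsymbol{t}\bigr)^{1/2}$. $\log$ is the natural logarithm. *)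

(* Defs.v *)
From HB Require Import structures.
From mathcomp Require Import all_boot all_order all_algebra.
From mathcomp Require Import finmap.
From mathcomp Require Import all_classical all_reals all_analysis.

Set Implicit Arguments.
Unset Strict Implicit.
Unset Printing Implicit Defensive.

Import Order.TTheory GRing.Theory Num.Theory.

Local Open Scope ring_scope.
Local Open Scope fset_scope.

(* Bits are booleans, so that [addb] is addition modulo 2 and [andb] is the
   product; they are coerced to 0 and 1 in R by [_%:R].
   Vectors are indexed from 1: [bit s k] is s_k, for 1 <= k <= size s. *)
Definition bit (s : seq bool) (k : nat) : bool := nth false s k.-1.

Definition ybit (n : nat) (a : n.-1.-tuple bool) (sigma t : n.-tuple bool)
    (k : nat) : bool :=
  if (k < n)%N
  then bit t k (+) (bit a k && bit t n) (+) bit sigma k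
  else bit t n (+) bit sigma n.

Definition pt (R : realType) (n : nat) (a : n.-1.-tuple bool)
    (sigma t : n.-tuple bool) : R * R :=
  (\sum_(1 <= k < n.+1) (bit t k)%:R / 2 ^+ (n.+1 - k),
   \sum_(1 <= k < n.+1) (ybit a sigma t k)%:R / 2 ^+ k).

Definition point_set (R : realType) (n : nat) (a : n.-1.-tuple bool)
    (sigma : n.-tuple bool) : {fset R * R} :=
  [fset pt R a sigma t | t in {: n.-tuple bool}].

Definition star (n : nat) (sigma : n.-tuple bool) : n.-tuple bool :=
  [tuple of map negb sigma].

Definition sym_point_set (R : realType) (n : nat) (a : n.-1.-tuple bool)
    (sigma : n.-tuple bool) : {fset R * R} :=
  point_set R a sigma `|` point_set R a (star sigma).

Definition discrepancy (R : realType) (P : {fset R * R}) (t : R * R) : R :=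
  (#|` [fset z in P | (z.1 \in `[0, t.1[) && (z.2 \in `[0, t.2[)] |)%:R
    / (#|` P |)%:R - t.1 * t.2.

Definition L2_discrepancy (R : realType) (P : {fset R * R}) : R :=
  Num.sqrt
    (\int[(lebesgue_measure \x lebesgue_measure)%E]_(t in
        (`[0%R, 1%R] `*` `[0%R, 1%R])%classic)
      (discrepancy P t) ^+ 2).

Definition Lsum (R : realType) (n : nat) (a : n.-1.-tuple bool)
    (sigma : n.-tuple bool) : R :=
  \sum_(1 <= i < n) (bit a i)%:R * (1 - 2 * (bit sigma i)%:R).

(* Main.v *)
Require Import Defs.
From mathcomp Require Import all_boot all_order all_algebra.
From mathcomp Require Import finmap.
From mathcomp Require Import all_classical all_reals all_analysis.
From mathcomp Require Import measurable_realfun.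
From mathcomp Require Import zify ring lra.

(** Warnock's formula turns the squared L2 discrepancy into sums over pairs and
    single points of [1 - max] and [1 - x^2] in each coordinate. Write the
    coordinates as [(K - 1 - xi) / (2 K)] and [(K - 1 - eta) / (2 K)], where
    [K = 2^n] and [xi], [eta] are sums of [+-2^k] signed by the binary digits;
    complementing sigma replaces [eta] by [- eta], so that pair sums only
    involve [|eta - eta'| + |eta + eta'|].
    Fix the last digit [tau = t_n]. The other [n - 1] digits then form a
    digitally shifted Hammersley set with shift [a_k tau + sigma_k], and all the
    sums satisfy linear recurrences in the number of digits: a new last digit is
    leading in [xi] and trailing in [eta]. They depend on the shift only through
    its bias, the sum of the signs [(-1)^(shift_k)]. Pairs with distinct [tau]
    are easy, since their [xi] are ordered by [tau] and, for fixed [tau], the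
    values [+-eta] run exactly once through the odd integers between [-K] and
    [K]. The squares of the two biases (for [tau = 0] and [tau = 1]) and their
    sum cancel in the total; their difference is [2 L]. *)

Set Implicit Arguments.
Unset Strict Implicit.
Unset Printing Implicit Defensive.

Import Order.TTheory GRing.Theory Num.Theory.
Import numFieldNormedType.Exports.
Local Open Scope ring_scope.
Local Open Scope classical_set_scope.
Local Open Scope fset_scope.
Local Open Scope ring_scope.

(** * Signed digit sums *)

Lemma sum_tuple_rcons (V : nmodType) n (F : seq bool -> V) :
  \sum_(t : n.+1.-tuple bool) F t =
  \sum_(t : n.-tuple bool) (F (rcons t false) + F (rcons t true)).
Proof.
pose h (p : n.-tuple bool * bool) : n.+1.-tuple bool := [tuple of rcons p.1 p.2].
pose g (t : n.+1.-tuple bool) : n.-tuple bool * bool :=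
  ([tuple of belast (thead t) (behead t)], last (thead t) (behead t)).
have hK : cancel g h.
  case=> -[|x s] // sz; apply/val_inj; rewrite /= /thead (tnth_nth x) /=.
  by rewrite -lastI.
have gK : cancel h g.
  move=> [t b]; apply/pair_eqP; rewrite /= /thead !(tnth_nth b) /=.
  apply/andP; split.
    apply/eqP/val_inj => /=; case: (tval t) => //= x s.
    by rewrite belast_rcons.
  by case: (tval t) => //= x s; rewrite last_rcons.
rewrite (reindex h) /=; last by exists g => ? _.
rewrite -(pair_bigA _ (fun t b => F (rcons (tval t) b))) /=.
by apply: eq_bigr => t _; rewrite big_bool addrC.
Qed.

Lemma sum_tuple_negb (V : nmodType) n (F : seq bool -> V) :
  \sum_(t : n.-tuple bool) F t = \sum_(t : n.-tuple bool) F (map negb t).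
Proof.
rewrite (reindex_inj (h := fun t : n.-tuple bool => [tuple of map negb t])) //.
apply: inv_inj => t; apply/val_inj => /=.
by rewrite -map_comp map_id_in // => b _ /=; rewrite negbK.
Qed.

Definition chi (b : bool) : int := (-1) ^+ b.

Definition xi (t : seq bool) : int :=
  \sum_(i < size t) 2 ^+ i * chi (nth false t i).

(** Positions count from 0, so position [i] holds the digit of index [i + 1] in [bit]. The shift is
    a function on [nat], so that one shift serves all lengths of [t]. *)
Definition eta (s : nat -> bool) (t : seq bool) : int :=
  \sum_(i < size t) 2 ^+ (size t - i.+1) * chi (nth false t i (+) s i).

Lemma chiD b c : chi (b (+) c) = chi b * chi c.
Proof. by case: b; case: c. Qed.

Lemma chi_negb b : chi (~~ b) = - chi b.
Proof. by case: b. Qed.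

Lemma chiP b : chi b = 1 \/ chi b = -1.
Proof. by case: b; [right|left]. Qed.

Lemma xi_nil : xi [::] = 0.
Proof. exact: big_ord0. Qed.

Lemma eta_nil s : eta s [::] = 0.
Proof. exact: big_ord0. Qed.

Lemma xi_rcons t b : xi (rcons t b) = xi t + 2 ^+ size t * chi b.
Proof.
rewrite /xi size_rcons big_ord_recr /= nth_rcons ltnn eqxx; congr (_ + _).
by apply: eq_bigr => i _; rewrite nth_rcons ltn_ord.
Qed.

Lemma eta_rcons s t b :
  eta s (rcons t b) = 2 * eta s t + chi b * chi (s (size t)).
Proof.
rewrite /eta size_rcons big_ord_recr /= nth_rcons ltnn eqxx subnn mul1r chiD.
congr (_ + _); rewrite mulr_sumr; apply: eq_bigr => i _.
by rewrite nth_rcons ltn_ord subSn // exprS mulrA.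
Qed.

Lemma xi_negb t : xi (map negb t) = - xi t.
Proof.
rewrite /xi size_map -sumrN; apply: eq_bigr => i _.
by rewrite (nth_map false) // chi_negb mulrN.
Qed.

Lemma eta_negb s t : eta s (map negb t) = - eta s t.
Proof.
rewrite /eta size_map -sumrN; apply: eq_bigr => i _.
by rewrite (nth_map false) // addNb chi_negb mulrN.
Qed.

Lemma xi_bound t : - (2 ^+ size t) < xi t < 2 ^+ size t.
Proof.
elim/last_ind: t => [|t b IH]; first by rewrite xi_nil.
by rewrite xi_rcons size_rcons exprS; case: (chiP b) => ->; lia.
Qed.

Lemma eta_bound s t : - (2 ^+ size t) < eta s t < 2 ^+ size t.
Proof.
elim/last_ind: t => [|t b IH]; first by rewrite eta_nil.
rewrite eta_rcons size_rcons exprS.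
by case: (chiP b) => ->; case: (chiP (s (size t))) => ->; lia.
Qed.

(** Only the last digit has an odd weight; the indicator covers the empty sequence, where the
    inductions start. *)
Lemma eta_parity s t : exists q : int, eta s t = 2 * q + (0 < size t)%N%:R.
Proof.
case/lastP: t => [|t b]; first by exists 0; rewrite eta_nil.
rewrite eta_rcons size_rcons /=.
case: (chiP b) => ->; case: (chiP (s (size t))) => ->.
- by exists (eta s t); lia.
- by exists (eta s t - 1); lia.
- by exists (eta s t - 1); lia.
- by exists (eta s t); lia.
Qed.

Lemma xi_inj (t u : seq bool) : size t = size u -> xi t = xi u -> t = u.
Proof.
elim/last_ind: t u => [|t b IH] u; case/lastP: u => [|u c]; rewrite ?size_rcons //.
move=> [eqs]; rewrite !xi_rcons eqs => eqx.
have := xi_bound t; have := xi_bound u; rewrite eqs => Bu Bt.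
have [eb eqx'] : b = c /\ xi t = xi u.
  by move: b c eqx => [] []; rewrite /chi /= => eqx; split => //; lia.
by rewrite eb (IH u).
Qed.

(** The doubled prefixes differ by a multiple of 4, while distinct last digits would contribute
    [+-2]. *)
Lemma eta_inj s (t u : seq bool) : size t = size u -> eta s t = eta s u -> t = u.
Proof.
elim/last_ind: t u => [|t b IH] u; case/lastP: u => [|u c]; rewrite ?size_rcons //.
move=> [eqs]; rewrite !eta_rcons eqs => eqx.
have [q Hq] := eta_parity s t; have [r Hr] := eta_parity s u.
have [eb eqx'] : b = c /\ eta s t = eta s u.
  move: Hq Hr; rewrite eqs.
  by case: b c eqx => [] []; rewrite /chi /=; case: (s (size u));
     rewrite /= => eqx Hq Hr; split => //; lia.
by rewrite eb (IH u).
Qed.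

(** * Recurrences in the number of digits *)

Lemma pow2S n : 2 ^+ n.+1 = 2 * 2 ^+ n :> int.
Proof. exact: exprS. Qed.

Definition bsum n (F : seq bool -> int) : int := \sum_(t : n.-tuple bool) F t.

Definition bsum2 n (F : seq bool -> seq bool -> int) : int :=
  bsum n (fun t => bsum n (F t)).

Lemma eq_bsum n F G :
  (forall t, size t = n -> F t = G t) -> bsum n F = bsum n G.
Proof. by move=> eFG; apply: eq_bigr => t _; rewrite eFG ?size_tuple. Qed.

Lemma bsum0 F : bsum 0 F = F [::].
Proof.
rewrite /bsum (big_pred1 [tuple]) // => t.
by apply/esym/eqP/val_inj => /=; rewrite (tuple0 t).
Qed.

Lemma bsumS n F : bsum n.+1 F = bsum n (fun t => F (rcons t false) + F (rcons t true)).
Proof. exact: sum_tuple_rcons. Qed.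

Lemma bsum_negb n F : bsum n F = bsum n (fun t => F (map negb t)).
Proof. exact: sum_tuple_negb. Qed.

Lemma bsumD n F G : bsum n (fun t => F t + G t) = bsum n F + bsum n G.
Proof. exact: big_split. Qed.

Lemma bsumN n F : bsum n (fun t => - F t) = - bsum n F.
Proof. exact: sumrN. Qed.

Lemma bsumZ n c F : bsum n (fun t => c * F t) = c * bsum n F.
Proof. by rewrite /bsum mulr_sumr. Qed.

Lemma bsum_cst n c : bsum n (fun=> c) = 2 ^+ n * c.
Proof.
rewrite /bsum sumr_const card_tuple card_bool.
by rewrite -[LHS]mulr_natl natrX.
Qed.

Definition bsumE := (bsumD, bsumN, bsumZ, bsum_cst).

Lemma bsum_exchange n m F :
  bsum n (fun t => bsum m (F t)) = bsum m (fun u => bsum n (F^~ u)).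
Proof. exact: exchange_big. Qed.

Lemma eq_bsum2 n F G :
  (forall t u, size t = n -> size u = n -> F t u = G t u) ->
  bsum2 n F = bsum2 n G.
Proof. by move=> eFG; apply: eq_bsum => t st; apply: eq_bsum => u; exact: eFG. Qed.

Lemma bsum20 F : bsum2 0 F = F [::] [::].
Proof. by rewrite /bsum2 !bsum0. Qed.

Lemma bsum2S n F : bsum2 n.+1 F = bsum2 n (fun t u =>
  F (rcons t false) (rcons u false) + F (rcons t true) (rcons u true) +
  (F (rcons t false) (rcons u true) + F (rcons t true) (rcons u false))).
Proof.
rewrite /bsum2 bsumS; apply: eq_bsum => t _; rewrite !bsumS -bsumD.
by apply: eq_bsum => u _; lia.
Qed.

Lemma bsum2D n F G : bsum2 n (fun t u => F t u + G t u) = bsum2 n F + bsum2 n G.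
Proof. by rewrite /bsum2 -bsumD; apply: eq_bsum => t _; rewrite bsumD. Qed.

Lemma bsum2N n F : bsum2 n (fun t u => - F t u) = - bsum2 n F.
Proof. by rewrite /bsum2 -bsumN; apply: eq_bsum => t _; rewrite bsumN. Qed.

Lemma bsum2Z n c F : bsum2 n (fun t u => c * F t u) = c * bsum2 n F.
Proof. by rewrite /bsum2 -bsumZ; apply: eq_bsum => t _; rewrite bsumZ. Qed.

Lemma bsum2_cst n c : bsum2 n (fun _ _ => c) = 2 ^+ n * (2 ^+ n * c).
Proof. by rewrite /bsum2 !bsumE. Qed.

Definition bsum2E := (bsum2D, bsum2N, bsum2Z, bsum2_cst).

Lemma bsum2_negb n F :
  bsum2 n F = bsum2 n (fun t u => F (map negb t) (map negb u)).
Proof. by rewrite /bsum2 bsum_negb; apply: eq_bsum => t _; rewrite bsum_negb. Qed.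

(** Complementing all digits negates both [xi] and [eta]; here and in the next three lemmas the
    summand is odd under it. *)
Lemma bsum_xi n : bsum n xi = 0.
Proof.
have := bsum_negb n xi; rewrite (@eq_bsum _ (fun t => xi (map negb t)) (fun t => - xi t)).
  by rewrite bsumN; lia.
by move=> t _; rewrite xi_negb.
Qed.

Lemma bsum_eta n s : bsum n (eta s) = 0.
Proof.
have := bsum_negb n (eta s).
rewrite (@eq_bsum _ (fun t => eta s (map negb t)) (fun t => - eta s t)).
  by rewrite bsumN; lia.
by move=> t _; rewrite eta_negb.
Qed.

Lemma bsum_xi_eta_sqr n s : bsum n (fun t => xi t * eta s t ^+ 2) = 0.
Proof.
have := bsum_negb n (fun t => xi t * eta s t ^+ 2).
rewrite (@eq_bsum _ (fun t => xi (map negb t) * _) (fun t => - (xi t * eta s t ^+ 2))).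
  by rewrite bsumN; lia.
by move=> t _; rewrite xi_negb eta_negb sqrrN mulNr.
Qed.

Lemma bsum_xi_sqr_eta n s : bsum n (fun t => xi t ^+ 2 * eta s t) = 0.
Proof.
have := bsum_negb n (fun t => xi t ^+ 2 * eta s t).
rewrite (@eq_bsum _ (fun t => xi (map negb t) ^+ 2 * _) (fun t => - (xi t ^+ 2 * eta s t))).
  by rewrite bsumN; lia.
by move=> t _; rewrite xi_negb eta_negb sqrrN mulrN.
Qed.

(** Closed forms are stated multiplied by their denominators, so that everything stays in [int]. *)
Lemma bsum_xi_sqr n : 3 * bsum n (fun t => xi t ^+ 2) = 2 ^+ n ^+ 3 - 2 ^+ n.
Proof.
elim: n => [|n IH]; first by rewrite bsum0 xi_nil.
rewrite bsumS (@eq_bsum _ _ (fun t => 2 * xi t ^+ 2 + 2 * 2 ^+ n ^+ 2)).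
  by rewrite !bsumE pow2S; move: (2 ^+ n : int) IH => M IH; lra.
by move=> t <-; rewrite !xi_rcons /chi /=; ring.
Qed.

Lemma bsum_eta_sqr n s : 3 * bsum n (fun t => eta s t ^+ 2) = 2 ^+ n ^+ 3 - 2 ^+ n.
Proof.
elim: n => [|n IH]; first by rewrite bsum0 eta_nil.
rewrite bsumS (@eq_bsum _ _ (fun t => 8 * eta s t ^+ 2 + 2)).
  by rewrite !bsumE pow2S; move: (2 ^+ n : int) IH => M IH; lra.
by move=> t st; rewrite !eta_rcons /chi /=; case: (s _); rewrite /=; ring.
Qed.

Definition bias (s : nat -> bool) n : int := \sum_(i < n) chi (s i).

Lemma biasS s n : bias s n.+1 = bias s n + chi (s n).
Proof. exact: big_ord_recr. Qed.

(** The new digit enters [xi] and [eta] with the same sign [chi b], which squares away and leaves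
    [chi (s n)]; this is how the bias arises. *)
Lemma bsum_xi_eta n s : 2 * bsum n (fun t => xi t * eta s t) = 2 ^+ n ^+ 2 * bias s n.
Proof.
elim: n => [|n IH]; first by rewrite bsum0 xi_nil /bias big_ord0; ring.
rewrite bsumS (@eq_bsum _ _ (fun t => 4 * (xi t * eta s t) + 2 * 2 ^+ n * chi (s n))).
  rewrite !bsumE biasS pow2S.
  have -> : forall x y : int, 2 * (4 * x + y) = 4 * (2 * x) + 2 * y by move=> *; ring.
  by rewrite IH; ring.
by move=> t <-; rewrite !xi_rcons !eta_rcons /chi /=; ring.
Qed.

(** The cross term of the recurrence contains [xi t * eta s t], whose sum is a multiple of the bias;
    it supplies the mixed term that completes the square of [bias s n.+1]. *)
Lemma bsum_xi_sqr_eta_sqr n s :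
  18 * bsum n (fun t => xi t ^+ 2 * eta s t ^+ 2) =
  2 ^+ n ^+ 3 * (9 * bias s n ^+ 2 - 9 * n%:Z - 4) + 2 * 2 ^+ n ^+ 5 + 2 * 2 ^+ n.
Proof.
elim: n => [|n IH]; first by rewrite bsum0 xi_nil /bias big_ord0; ring.
rewrite bsumS (@eq_bsum _ _ (fun t => 8 * (xi t ^+ 2 * eta s t ^+ 2) + 2 * xi t ^+ 2
  + 8 * 2 ^+ n ^+ 2 * eta s t ^+ 2 + 2 * 2 ^+ n ^+ 2
  + 16 * 2 ^+ n * chi (s n) * (xi t * eta s t))); last first.
  move=> t <-; rewrite !xi_rcons !eta_rcons /chi /=.
  by case: (s _); rewrite /=; ring.
rewrite !bsumE biasS pow2S.
(* Regroups the sums into the multiples whose closed forms are known. *)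
have h : forall a b c d x : int,
  18 * (8 * a + 2 * b + 8 * x ^+ 2 * c + 2 * (x * x ^+ 2)
    + 16 * x * chi (s n) * d) =
  8 * (18 * a) + 12 * (3 * b) + 48 * x ^+ 2 * (3 * c) + 36 * x ^+ 3
    + 144 * x * chi (s n) * (2 * d).
  by move=> *; ring.
rewrite h IH bsum_xi_sqr bsum_eta_sqr bsum_xi_eta intS.
have sq : chi (s n) ^+ 2 = 1 by case: (chiP (s n)) => ->.
rewrite sqrrD sq; ring.
Qed.

(** * Sums over pairs of digit sequences *)

Lemma eta_evenB s t u : size t = size u ->
  exists q : int, eta s t - eta s u = 2 * q.
Proof.
move=> e; have [q ->] := eta_parity s t; have [r ->] := eta_parity s u.
by exists (q - r); rewrite e; ring.
Qed.

Lemma eta_evenD s t u : size t = size u ->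
  exists q : int, eta s t + eta s u = 2 * q.
Proof.
move=> e; have [q ->] := eta_parity s t; have [r ->] := eta_parity s u.
by exists (q + r + (0 < size u)%N%:R); rewrite e; ring.
Qed.

(** [|x + y| + |x - y|] is twice the larger of [|x|] and [|y|], so [e] is visible only at
    [v = 0]. *)
Lemma normrD1_even (v e : int) : (exists q, v = 2 * q) -> e = 1 \/ e = -1 ->
  `|2 * v + 2 * e| + `|2 * v - 2 * e| = 4 * `|v| + 4 * (v == 0)%:R.
Proof.
move=> [q ->] [] ->; case: eqP => /= [|] h; lia.
Qed.

Lemma normrB1_even (v e : int) : (exists q, v = 2 * q) -> e = 1 \/ e = -1 ->
  `|2 * v + 2 * e| - `|2 * v - 2 * e| = 4 * e * Num.sg v.
Proof.
by move=> [q ->] [] ->; case: sgrP => h; lia.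
Qed.

(** Since [eta s] is injective, exactly the diagonal pairs count. In the recurrence, distinct last
    digits never give equality because the difference of the prefixes is even. *)
Lemma bsum2_eta_eq n s :
  bsum2 n (fun t u => (eta s t - eta s u == 0)%:R) = 2 ^+ n.
Proof.
elim: n => [|n IH]; first by rewrite bsum20 !eta_nil.
rewrite bsum2S (@eq_bsum2 _ _ (fun t u => 2 * (eta s t - eta s u == 0)%:R)).
  by rewrite !bsum2E IH pow2S.
move=> t u st su; rewrite !eta_rcons st su.
have [q vq] := eta_evenB s (etrans st (esym su)).
by case: (chiP (s n)) => ->; rewrite /chi /=; lia.
Qed.

(** Exactly the pairs of complementary sequences count; here it is equal last digits that parity
    rules out. *)
Lemma bsum2_eta_opp n s :
  bsum2 n (fun t u => (eta s t + eta s u == 0)%:R) = 2 ^+ n.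
Proof.
elim: n => [|n IH]; first by rewrite bsum20 !eta_nil.
rewrite bsum2S (@eq_bsum2 _ _ (fun t u => 2 * (eta s t + eta s u == 0)%:R)).
  by rewrite !bsum2E IH pow2S.
move=> t u st su; rewrite !eta_rcons st su.
have [q vq] := eta_evenD s (etrans st (esym su)).
by case: (chiP (s n)) => ->; rewrite /chi /=; lia.
Qed.

(** The new digit is leading, so distinct last digits decide the order of the two [xi]; with
    [z = xi t - xi u] these two pairs add up to [(2 * 2^n + z) + (2 * 2^n - z)]. *)
Lemma bsum2_xi_dist n : 3 * bsum2 n (fun t u => `|xi t - xi u|) =
  2 * 2 ^+ n * (2 ^+ n ^+ 2 - 1).
Proof.
elim: n => [|n IH]; first by rewrite bsum20 !xi_nil.
rewrite bsum2S (@eq_bsum2 _ _ (fun t u => 2 * `|xi t - xi u| + 4 * 2 ^+ n)).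
  by rewrite !bsum2E pow2S; move: (2 ^+ n : int) IH => M IH; lra.
move=> t u st su; rewrite !xi_rcons st su /chi /=.
have := xi_bound t; have := xi_bound u; rewrite st su.
by move: (2 ^+ n : int) => M; lia.
Qed.

Lemma bsum2_etaB n s : 3 * bsum2 n (fun t u => `|eta s t - eta s u|) =
  2 * 2 ^+ n * (2 ^+ n ^+ 2 - 1).
Proof.
elim: n => [|n IH]; first by rewrite bsum20 !eta_nil.
rewrite bsum2S (@eq_bsum2 _ _ (fun t u => 8 * `|eta s t - eta s u| +
  4 * (eta s t - eta s u == 0)%:R)).
  by rewrite !bsum2E bsum2_eta_eq pow2S; move: (2 ^+ n : int) IH => M IH; lra.
move=> t u st su; rewrite !eta_rcons st su.
have := normrD1_even (eta_evenB s (etrans st (esym su))) (chiP (s n)).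
by case: (chiP (s n)) => ->; rewrite /chi /=; lia.
Qed.

Lemma bsum2_etaD n s : 3 * bsum2 n (fun t u => `|eta s t + eta s u|) =
  2 * 2 ^+ n * (2 ^+ n ^+ 2 - 1).
Proof.
elim: n => [|n IH]; first by rewrite bsum20 !eta_nil.
rewrite bsum2S (@eq_bsum2 _ _ (fun t u => 8 * `|eta s t + eta s u| +
  4 * (eta s t + eta s u == 0)%:R)).
  by rewrite !bsum2E bsum2_eta_opp pow2S; move: (2 ^+ n : int) IH => M IH; lra.
move=> t u st su; rewrite !eta_rcons st su.
have := normrD1_even (eta_evenD s (etrans st (esym su))) (chiP (s n)).
by case: (chiP (s n)) => ->; rewrite /chi /=; lia.
Qed.

Lemma xi_rconsB t u b c : size t = size u ->
  xi (rcons t b) - xi (rcons u c) =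
  xi t - xi u + 2 ^+ size u * (chi b - chi c).
Proof. by move=> e; rewrite !xi_rcons e; ring. Qed.

Lemma eta_rconsB s t u b c : size t = size u ->
  eta s (rcons t b) - eta s (rcons u c) =
  2 * (eta s t - eta s u) + chi (s (size u)) * (chi b - chi c).
Proof. by move=> e; rewrite !eta_rcons e; ring. Qed.

Lemma eta_rconsD s t u b c : size t = size u ->
  eta s (rcons t b) + eta s (rcons u c) =
  2 * (eta s t + eta s u) + chi (s (size u)) * (chi b + chi c).
Proof. by move=> e; rewrite !eta_rcons e; ring. Qed.

Lemma sgr2_even (v e : int) : (exists q, v = 2 * q) -> e = 1 \/ e = -1 ->
  Num.sg (2 * v + 2 * e) = Num.sg v + e * (v == 0)%:R.
Proof.
by move=> [q ->] [] ->; do 2! case: sgrP => ? /=; lia.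
Qed.

(** For distinct last digits the sign of the [eta] difference is that of the prefixes except on
    ties, where it is [+- chi (s n)], with the same [+-] as in the shift [+- 2 * 2^n] of the [xi]
    difference. Each of the [2^n] ties thus contributes [4 * 2^n * chi (s n)]. *)
Lemma bsum2_sign n s :
  bsum2 n (fun t u => (xi t - xi u) * Num.sg (eta s t - eta s u)) =
  2 ^+ n ^+ 2 * bias s n.
Proof.
elim: n => [|n IH].
  by rewrite bsum20 !xi_nil /bias big_ord0 subrr mul0r mulr0.
rewrite bsum2S (@eq_bsum2 _ _ (fun t u =>
  4 * ((xi t - xi u) * Num.sg (eta s t - eta s u)) +
  4 * 2 ^+ n * chi (s n) * (eta s t - eta s u == 0)%:R)).
  by rewrite !bsum2E bsum2_eta_eq pow2S biasS IH; ring.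
move=> t u st su; have etu := etrans st (esym su).
rewrite !xi_rconsB // !eta_rconsB // su.
have vq := eta_evenB s etu.
have zv : eta s t - eta s u = 0 -> xi t - xi u = 0.
  by move/eqP; rewrite subr_eq0 => /eqP/(eta_inj etu) ->; rewrite subrr.
move: (xi t - xi u) (eta s t - eta s u) (2 ^+ n : int) vq zv => z v M vq zv.
have e1 := chiP (s n); move: (chi (s n)) e1 => e e1.
have e2 : - e = 1 \/ - e = -1 by case: e1 => ->; [right | left].
have := sgr2_even vq e1; have := sgr2_even vq e2.
rewrite /chi /= !(expr0, expr1) !subrr !mulr0 !addr0.
have -> : e * (1 - -1) = 2 * e by ring.
have -> : e * (-1 - 1) = 2 * - e by ring.
move=> -> ->; rewrite sgrM (_ : Num.sg 2 = 1) // mul1r.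
case: eqP => [/zv ->|_] /=; ring.
Qed.

(* Without the indicator term the closed form would fail for [n = 0]. *)
Lemma bsum2_dist n s :
  18 * bsum2 n (fun t u => `|xi t - xi u| * (`|eta s t - eta s u|
    + `|eta s t + eta s u| + (eta s t + eta s u == 0)%:R)) =
  2 ^+ n ^+ 2 * (9 * bias s n ^+ 2 - 3 * n%:Z - 16) + 16 * 2 ^+ n ^+ 4.
Proof.
elim: n => [|n IH].
  by rewrite bsum20 !xi_nil /bias big_ord0 subrr normr0 mul0r; ring.
(* Equal last digits reproduce 4 times the old summand: the new indicator vanishes by parity, and
   the old one comes back from [normrD1_even]. For distinct last digits the [xi] distance is
   [2 * 2^n + z] or [2 * 2^n - z]; the constant part gives the distance and indicator sums, the part
   in [z] gives the sum of [bsum2_sign]. *)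
rewrite bsum2S (@eq_bsum2 _ _ (fun t u =>
  4 * (`|xi t - xi u| * (`|eta s t - eta s u|
    + `|eta s t + eta s u| + (eta s t + eta s u == 0)%:R))
  + 8 * 2 ^+ n * `|eta s t - eta s u| + 8 * 2 ^+ n * `|eta s t + eta s u|
  + 8 * 2 ^+ n * (eta s t - eta s u == 0)%:R
  + 4 * 2 ^+ n * (eta s t + eta s u == 0)%:R
  + 4 * chi (s n) * ((xi t - xi u) * Num.sg (eta s t - eta s u)))).
  rewrite !bsum2E bsum2_eta_eq bsum2_eta_opp bsum2_sign pow2S biasS intS.
  have h : forall a b c M f g : int,
    18 * (4 * a + 8 * M * b + 8 * M * c + f + g) =
    4 * (18 * a) + 48 * M * (3 * b) + 48 * M * (3 * c) + 18 * f + 18 * g.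
    by move=> *; ring.
  rewrite -!addrA !addrA -[in LHS]addrA h IH bsum2_etaB bsum2_etaD.
  have sq : chi (s n) ^+ 2 = 1 by case: (chiP (s n)) => ->.
  by rewrite sqrrD sq; ring.
move=> t u st su; have etu := etrans st (esym su).
rewrite !xi_rconsB // !eta_rconsB // !eta_rconsD // su.
have vq := eta_evenB s etu; have wq := eta_evenD s etu.
have zM : - (2 * 2 ^+ n) < xi t - xi u < 2 * 2 ^+ n.
  by have := xi_bound t; have := xi_bound u; rewrite st su; lia.
move: (xi t - xi u) (eta s t - eta s u) (eta s t + eta s u) (2 ^+ n : int) vq wq zM.
move=> z v w M vq wq zM.
have e1 := chiP (s n); move: (chi (s n)) e1 => e e1.
have := normrD1_even vq e1; have := normrB1_even vq e1.
have := normrD1_even wq e1.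
rewrite /chi /= !(expr0, expr1) !subrr !mulr0 !addr0.
have -> : e * (1 - -1) = 2 * e by ring.
have -> : e * (-1 - 1) = - (2 * e) by ring.
have -> : M * (1 - -1) = 2 * M by ring.
have -> : M * (-1 - 1) = - (2 * M) by ring.
have -> : (2 * w + 2 * e == 0) = false by move: wq e1 => [q ->] [] ->; lia.
have -> : (2 * w - 2 * e == 0) = false by move: wq e1 => [q ->] [] ->; lia.
have -> : `|z + 2 * M| = 2 * M + z by lia.
have -> : `|z - 2 * M| = 2 * M - z by lia.
have -> : (2 * w == 0) = (w == 0) by lia.
have -> : `|2 * v| = 2 * `|v| by lia.
have -> : `|2 * w| = 2 * `|w| by lia.
rewrite /= !addr0.
move: `|2 * w + 2 * e| `|2 * w - 2 * e| `|2 * v + 2 * e| `|2 * v - 2 * e|.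
move=> a b c d H1 H2 H3.
have -> : a = 4 * `|w| + 4 * (w == 0)%:R - b by lra.
have -> : c = 2 * `|v| + 2 * (v == 0)%:R + 2 * e * Num.sg v by lia.
have -> : d = 2 * `|v| + 2 * (v == 0)%:R - 2 * e * Num.sg v by lia.
ring.
Qed.

(** * Dependence of the shift on the last digit *)

Lemma int_parity (y : int) : (exists q, y = 2 * q) \/ (exists q, y = 2 * q + 1).
Proof.
have := divz_eq y 2; have := modz_ge0 y (isT : 2 != 0 :> int).
have := ltz_mod y (isT : 2 != 0 :> int) => h1 h2 h3.
have [h|h] : (y %% 2)%Z = 0 \/ (y %% 2)%Z = 1 by lia.
- by left; exists (y %/ 2)%Z; lia.
- by right; exists (y %/ 2)%Z; lia.
Qed.

(** For [n > 0] the values of [eta s] are the odd integers between [- 2^n] and [2^n], each taken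
    once, and one of [y], [y + 1] is odd. The induction halves [y]. *)
Lemma bsum_eta_consecutive n s (y : int) : - (2 ^+ n) <= y < 2 ^+ n ->
  bsum n (fun t => (y == eta s t)%:R + (y + 1 == eta s t)%:R) = 1.
Proof.
elim: n y => [|n IH] y; first by rewrite bsum0 eta_nil expr0; lia.
rewrite pow2S bsumS => yK.
have [[q yq]|[q yq]] := int_parity y.
- rewrite -[RHS](IH q); last by lia.
  apply: eq_bsum => t st; rewrite !eta_rcons yq st.
  by case: (chiP (s n)) => ->; rewrite /chi /=; lia.
- rewrite -[RHS](IH q); last by lia.
  apply: eq_bsum => t st; rewrite !eta_rcons yq st.
  by case: (chiP (s n)) => ->; rewrite /chi /=; lia.
Qed.

(** The indicator makes one formula valid for both parities of [y] and for [n = 0], as the induction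
    by halving [y] requires. *)
Lemma bsum_dist_eta n s (y : int) : - (2 ^+ n) <= y <= 2 ^+ n ->
  bsum n (fun t => 2 * `|y - eta s t| + (y == eta s t)%:R) = y ^+ 2 + 2 ^+ n ^+ 2.
Proof.
elim: n y => [|n IH] y.
  rewrite bsum0 eta_nil expr0 => hy.
  by have [->|[->|->]] : y = -1 \/ y = 0 \/ y = 1 by lia.
rewrite pow2S bsumS => yK.
have [[q yq]|[q yq]] := int_parity y.
- rewrite (@eq_bsum _ _ (fun t => 4 * (2 * `|q - eta s t| + (q == eta s t)%:R))).
    by rewrite bsumZ IH ?yq; [ring | lia].
  move=> t st; rewrite !eta_rcons yq st.
  by case: (chiP (s n)) => ->; rewrite /chi /=; lia.
(* An odd [y = 2q + 1] lies between the doubles of [q] and [q + 1], so its distances to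
   [2 * eta s t +- 1] combine those of [q] and [q + 1]; the subtracted indicators sum to 1. *)
- rewrite (@eq_bsum _ _ (fun t => 2 * (2 * `|q - eta s t| + (q == eta s t)%:R)
     + 2 * (2 * `|q + 1 - eta s t| + (q + 1 == eta s t)%:R)
     - ((q == eta s t)%:R + (q + 1 == eta s t)%:R))).
    rewrite bsumD bsumN bsum_eta_consecutive; last by lia.
    by rewrite bsumD !bsumZ !IH ?yq; [ring | lia | lia].
  move=> t st; rewrite !eta_rcons yq st.
  by case: (chiP (s n)) => ->; rewrite /chi /=; lia.
Qed.

(** An odd [y] is hit exactly once, since the even [y + 1] never is; this accounts for the [- 1]. *)
Lemma bsum_dist_eta_odd n s (y : int) :
  - (2 ^+ n.+1) < y < 2 ^+ n.+1 -> (exists q, y = 2 * q + 1) ->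
  2 * bsum n.+1 (fun t => `|y - eta s t|) = y ^+ 2 + 2 ^+ n.+1 ^+ 2 - 1.
Proof.
move=> yK [q yq].
transitivity (bsum n.+1 (fun t => 2 * `|y - eta s t| + (y == eta s t)%:R) -
  bsum n.+1 (fun t => (y == eta s t)%:R + (y + 1 == eta s t)%:R)).
  rewrite -bsumZ -bsumN -bsumD; apply: eq_bsum => t st.
  have [r] := eta_parity s t; rewrite st /= => Hr.
  have -> : (y + 1 == eta s t) = false by lia.
  by rewrite addr0 addrK.
rewrite bsum_dist_eta; last by lia.
by rewrite bsum_eta_consecutive //; lia.
Qed.

(** With the last sign [e] fixed, the numbers [2 * eta s t + e] and their negatives together are the
    values of [eta s] on [n + 1] digits: complementing [t] turns the negatives into the values with
    the other last sign. *)
Lemma bsum_sym_dist_eta n s (y e : int) :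
  - (2 ^+ n.+1) < y < 2 ^+ n.+1 -> (exists q, y = 2 * q + 1) ->
  e = 1 \/ e = -1 ->
  2 * bsum n (fun t => `|y - (2 * eta s t + e)| + `|y + (2 * eta s t + e)|) =
  y ^+ 2 + 2 ^+ n.+1 ^+ 2 - 1.
Proof.
move=> yK yq e1; rewrite -(bsum_dist_eta_odd s yK yq) bsumS; congr (_ * _).
rewrite !bsumD [X in _ + X]bsum_negb -!bsumD; apply: eq_bsum => t st.
rewrite !eta_rcons eta_negb; case: e1 => ->.
  by case: (chiP (s (size t))) => ->; rewrite /chi /=; lia.
by case: (chiP (s (size t))) => ->; rewrite /chi /=; lia.
Qed.

Definition digit_shift (a sg : nat -> bool) (tau : bool) (i : nat) : bool :=
  (a i && tau) (+) sg i.

(* [eta] of the point with parameter [t], whose last digit selects the shift. *)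
Definition full_eta (a sg : nat -> bool) (t : seq bool) : int :=
  eta (digit_shift a sg (last false t)) t.

Definition sym_dist (a sg : nat -> bool) (t u : seq bool) : int :=
  `|full_eta a sg t - full_eta a sg u| + `|full_eta a sg t + full_eta a sg u|.

Lemma full_eta_bound a sg t : - (2 ^+ size t) < full_eta a sg t < 2 ^+ size t.
Proof. exact: eta_bound. Qed.

Lemma full_eta_odd a sg n t : size t = n.+1 ->
  exists q, full_eta a sg t = 2 * q + 1.
Proof.
move=> st; have [q] := eta_parity (digit_shift a sg (last false t)) t.
by rewrite st; exists q.
Qed.

(** * Sums over all [n + 1] digits, combined from the two values of the last one *)

Section Full.
Variables (n : nat) (a sg : nat -> bool).
(** Position [n] is the last of [n + 1] digits, where the vector [a] has no entry; both values of
    the last digit therefore see the same shift sign [e] there. *)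
Hypothesis an : a n = false.

Let e := chi (sg n).
Let M : int := 2 ^+ n.
Let s0 := digit_shift a sg false.
Let s1 := digit_shift a sg true.

Lemma full_eta_rcons u b : size u = n ->
  full_eta a sg (rcons u b) = 2 * eta (digit_shift a sg b) u + chi b * e.
Proof.
by move=> su; rewrite /full_eta last_rcons eta_rcons su {2}/digit_shift an.
Qed.

Lemma chi_e b : chi b * e = 1 \/ chi b * e = -1.
Proof. by rewrite -chiD; exact: chiP. Qed.

(** Whatever the last digit of [t], the sum sees [t] only through [full_eta a sg t], which decouples
    pairs with distinct last digits. *)
Lemma bsum_sym_dist_rcons t b : size t = n.+1 ->
  2 * bsum n (fun u => sym_dist a sg t (rcons u b)) =
  full_eta a sg t ^+ 2 + 2 ^+ n.+1 ^+ 2 - 1.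
Proof.
move=> st.
rewrite -(@bsum_sym_dist_eta _ (digit_shift a sg b) _ (chi b * e)) //; last 3 first.
- by have := full_eta_bound a sg t; rewrite st.
- exact: full_eta_odd st.
- exact: chi_e.
congr (_ * _); apply: eq_bsum => u su.
by rewrite /sym_dist full_eta_rcons.
Qed.

Lemma bsum_sym_dist t : size t = n.+1 ->
  bsum n.+1 (sym_dist a sg t) = full_eta a sg t ^+ 2 + 2 ^+ n.+1 ^+ 2 - 1.
Proof.
move=> st; rewrite bsumS bsumD.
by have := bsum_sym_dist_rcons false st; have := bsum_sym_dist_rcons true st; lia.
Qed.

Lemma bsum_full_eta_sqr :
  3 * bsum n.+1 (fun t => full_eta a sg t ^+ 2) = 2 ^+ n.+1 ^+ 3 - 2 ^+ n.+1.
Proof.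
rewrite bsumS (@eq_bsum _ _ (fun t => 4 * eta s0 t ^+ 2 + 4 * e * eta s0 t +
  4 * eta s1 t ^+ 2 - 4 * e * eta s1 t + 2)).
  rewrite !bsumE !bsum_eta pow2S.
  have := bsum_eta_sqr n s0; have := bsum_eta_sqr n s1.
  by move: (2 ^+ n : int) (bsum n _) (bsum n _) => K x y h1 h2; lra.
move=> t st; rewrite !full_eta_rcons // -/s0 -/s1 /chi /=.
by have := chi_e false; rewrite /chi /= mul1r => -[] ->; ring.
Qed.

(** The one source of the difference of the biases, hence of [L]: the leading parts [+- M] of [xi]
    cancel between the two last digits, and the cross terms [+- 4 * e * (xi t * eta s t)] remain. *)
Lemma bsum_xi_full_eta_sqr :
  bsum n.+1 (fun t => xi t * full_eta a sg t ^+ 2) =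
  2 * e * M ^+ 2 * (bias s0 n - bias s1 n).
Proof.
rewrite bsumS (@eq_bsum _ _ (fun t =>
  4 * (xi t * eta s0 t ^+ 2) + 4 * e * (xi t * eta s0 t) + xi t
  + M * (4 * eta s0 t ^+ 2 + 4 * e * eta s0 t)
  + (4 * (xi t * eta s1 t ^+ 2) + - (4 * e) * (xi t * eta s1 t) + xi t
  + - M * (4 * eta s1 t ^+ 2 + - (4 * e) * eta s1 t)))).
  rewrite !bsumE !bsum_eta !bsum_xi !bsum_xi_eta_sqr.
  have := bsum_eta_sqr n s0; have := bsum_eta_sqr n s1.
  set c0 := bsum n (fun t => eta s0 t ^+ 2); set c1 := bsum n (fun t => eta s1 t ^+ 2).
  move=> h1 h0; have -> : c1 = c0 by lia.
  have k s : 2 * e * M ^+ 2 * bias s n = 2 * e * (2 * bsum n (fun t => xi t * eta s t)).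
    by rewrite bsum_xi_eta -/M; ring.
  by rewrite mulrBr !k; ring.
move=> t st; rewrite !xi_rcons !full_eta_rcons // -/s0 -/s1 /chi st /= -/M.
by have := chi_e false; rewrite /chi /= mul1r => -[] ->; ring.
Qed.

Lemma bsum_xi_sqr_full_eta_sqr :
  9 * bsum n.+1 (fun t => xi t ^+ 2 * full_eta a sg t ^+ 2) =
  18 * M ^+ 3 * (bias s0 n ^+ 2 + bias s1 n ^+ 2)
  + 36 * M ^+ 3 * e * (bias s0 n + bias s1 n)
  + 32 * M ^+ 5 - (36 * n%:Z + 16) * M ^+ 3 + 2 * M.
Proof.
have h s (b : bool) : 18 * bsum n (fun t =>
    (xi t + M * chi b) ^+ 2 * (2 * eta s t + chi b * e) ^+ 2) =
  36 * M ^+ 3 * bias s n ^+ 2 + 72 * M ^+ 3 * e * bias s n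
  + 32 * M ^+ 5 - (36 * n%:Z + 16) * M ^+ 3 + 2 * M.
  (* The bracket that ends the new summand collects the terms odd in [chi b]; each sums to 0 by
     complementation. *)
  rewrite (@eq_bsum _ _ (fun t => 4 * (xi t ^+ 2 * eta s t ^+ 2) + xi t ^+ 2
    + 4 * M ^+ 2 * eta s t ^+ 2 + 8 * M * e * (xi t * eta s t) + M ^+ 2
    + (4 * (chi b * e) * (xi t ^+ 2 * eta s t) + 8 * M * chi b * (xi t * eta s t ^+ 2)
    + 2 * M * chi b * xi t + 4 * M ^+ 2 * (chi b * e) * eta s t))).
    rewrite !(bsumD, bsumZ) bsum_cst bsum_eta bsum_xi bsum_xi_eta_sqr.
    rewrite bsum_xi_sqr_eta !mulr0 !addr0 -/M.
    have k : forall x y z w c : int, 18 * (4 * x + y + 4 * M ^+ 2 * z + 8 * M * e * w + c) =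
      4 * (18 * x) + 6 * (3 * y) + 24 * M ^+ 2 * (3 * z) + 72 * M * e * (2 * w) + 18 * c.
      by move=> *; ring.
    rewrite k bsum_xi_sqr_eta_sqr bsum_xi_sqr bsum_eta_sqr bsum_xi_eta -/M.
    by ring.
  move=> t _; have := chi_e false; have := chiP b.
  by rewrite [chi false]/chi /= mul1r => -[] -> [] ->; ring.
rewrite bsumS (@eq_bsum _ _ (fun t =>
    (xi t + M * chi false) ^+ 2 * (2 * eta s0 t + chi false * e) ^+ 2 +
    (xi t + M * chi true) ^+ 2 * (2 * eta s1 t + chi true * e) ^+ 2)).
  rewrite bsumD; have := h s0 false; have := h s1 true.
  set x := bsum n _; set y := bsum n _ => h1 h0.
  apply: (@mulfI _ (2 : int)) => //; rewrite mulrA mulrDr.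
  by have -> : 2 * 9 = 18 :> int by []; rewrite h0 h1; ring.
by move=> t st; rewrite !xi_rcons !full_eta_rcons // st.
Qed.

Lemma sym_distC t u : sym_dist a sg t u = sym_dist a sg u t.
Proof. by rewrite /sym_dist distrC addrC [X in _ + `|X|]addrC addrC. Qed.

(** Complementing [t] and [u] together flips the sign of [c]; averaging the two forms makes
    [normrD1_even] applicable. *)
Lemma bsum2_dist_diag s (c : int) : c = 1 \/ c = -1 ->
  bsum2 n (fun t u => `|xi t - xi u| *
    (`|2 * (eta s t - eta s u)| + `|2 * (eta s t + eta s u) + 2 * c|)) =
  2 * bsum2 n (fun t u => `|xi t - xi u| * (`|eta s t - eta s u|
    + `|eta s t + eta s u| + (eta s t + eta s u == 0)%:R)).
Proof.
move=> c1; set X := bsum2 n _; set Y := bsum2 n _.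
have X' : X = bsum2 n (fun t u => `|xi t - xi u| *
    (`|2 * (eta s t - eta s u)| + `|2 * (eta s t + eta s u) - 2 * c|)).
  rewrite /X bsum2_negb; apply: eq_bsum2 => t u _ _.
  by rewrite !xi_negb !eta_negb; congr (_ * (_ + _)); lia.
suff : X + X = 4 * Y by lia.
rewrite {2}X' /X /Y -bsum2D -bsum2Z; apply: eq_bsum2 => t u st su.
have := normrD1_even (eta_evenD s (etrans st (esym su))) c1.
move=> h; rewrite -[LHS]mulrDr [X in _ * X = _]addrACA h.
 have -> : `|2 * (eta s t - eta s u)| = 2 * `|eta s t - eta s u| by lia.
by ring.
Qed.

(** Equal last digits lead to [bsum2_dist] for each of the two shifts. For distinct last digits the
    [xi] distance is linear in [xi t] and [xi u], so one variable can be summed out. *)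
Lemma bsum2_xi_sym_dist :
  9 * bsum2 n.+1 (fun t u => `|xi t - xi u| * sym_dist a sg t u) =
  9 * M ^+ 2 * (bias s0 n ^+ 2 + bias s1 n ^+ 2)
  + 18 * M ^+ 2 * e * (bias s0 n + bias s1 n)
  + 128 * M ^+ 4 - (6 * n%:Z + 56) * M ^+ 2.
Proof.
rewrite bsum2S !bsum2D.
have diag b : bsum2 n (fun t u => `|xi (rcons t b) - xi (rcons u b)| *
    sym_dist a sg (rcons t b) (rcons u b)) =
  2 * bsum2 n (fun t u => let s := digit_shift a sg b in
    `|xi t - xi u| * (`|eta s t - eta s u|
      + `|eta s t + eta s u| + (eta s t + eta s u == 0)%:R)).
  rewrite -(bsum2_dist_diag _ (chi_e b)); apply: eq_bsum2 => t u st su.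
  rewrite xi_rconsB ?st ?su // subrr mulr0 addr0 /sym_dist !full_eta_rcons //.
  congr (_ * _); congr (_ + _); congr `|_|; ring.
pose Phi t u := sym_dist a sg (rcons t false) (rcons u true).
have xiM t : size t = n -> - M < xi t < M by move=> st; have := xi_bound t; rewrite st.
have off1 : bsum2 n (fun t u => `|xi (rcons t false) - xi (rcons u true)| *
    sym_dist a sg (rcons t false) (rcons u true)) =
    bsum2 n (fun t u => (2 * M + xi t - xi u) * Phi t u).
  apply: eq_bsum2 => t u st su; rewrite xi_rconsB ?st ?su // -/M; congr (_ * _).
  by have := xiM _ st; have := xiM _ su; rewrite /chi /=; lia.
have off2 : bsum2 n (fun t u => `|xi (rcons t true) - xi (rcons u false)| *
    sym_dist a sg (rcons t true) (rcons u false)) =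
    bsum2 n (fun t u => (2 * M + xi t - xi u) * Phi t u).
  rewrite /bsum2 bsum_exchange; apply: eq_bsum => t st; apply: eq_bsum => u su.
  rewrite xi_rconsB ?st ?su // -/M sym_distC; congr (_ * _).
  by have := xiM _ st; have := xiM _ su; rewrite /chi /=; lia.
rewrite !diag off1 off2.
(* The part with weight [2 * M + xi t] is summed over [u] first, the part with weight [xi u] over
   [t] first. *)
have off : 2 * bsum2 n (fun t u => (2 * M + xi t - xi u) * Phi t u) =
   bsum n (fun t => (2 * M + xi t) *
     (full_eta a sg (rcons t false) ^+ 2 + 2 ^+ n.+1 ^+ 2 - 1))
   - bsum n (fun u => xi u *
     (full_eta a sg (rcons u true) ^+ 2 + 2 ^+ n.+1 ^+ 2 - 1)).
  rewrite (@eq_bsum2 _ _ (fun t u => (2 * M + xi t) * Phi t u - xi u * Phi t u)); last first.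
    by move=> *; ring.
  rewrite bsum2D bsum2N mulrBr; congr (_ - _).
    rewrite /bsum2 -bsumZ; apply: eq_bsum => t st.
    by rewrite bsumZ mulrCA bsum_sym_dist_rcons ?size_rcons ?st.
  rewrite /bsum2 bsum_exchange -bsumZ; apply: eq_bsum => u su.
  rewrite bsumZ mulrCA -(@bsum_sym_dist_rcons _ false) ?size_rcons ?su //.
  by congr (_ * (_ * _)); apply: eq_bsum => t st; rewrite /Phi sym_distC.
have e2 : e ^+ 2 = 1 by rewrite /e; case: (chiP (sg n)) => ->.
rewrite (@eq_bsum _ _ (fun t =>
  2 * M * (4 * eta s0 t ^+ 2 + 4 * e * eta s0 t + 4 * M ^+ 2)
  + 4 * (xi t * eta s0 t ^+ 2) + 4 * e * (xi t * eta s0 t)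
  + 4 * M ^+ 2 * xi t)) in off; last first.
  move=> t st; rewrite full_eta_rcons // -/s0 pow2S -/M.
  rewrite [chi false]/chi /= expr0 mul1r sqrrD e2; ring.
rewrite [X in _ - X](@eq_bsum _ _ (fun t =>
   4 * (xi t * eta s1 t ^+ 2) + - (4 * e) * (xi t * eta s1 t)
   + 4 * M ^+ 2 * xi t)) in off; last first.
  move=> t st; rewrite full_eta_rcons // -/s1 pow2S -/M.
  rewrite [chi true]/chi /= expr1 sqrrD mulN1r sqrrN e2; ring.
move: off; rewrite !bsumE !bsum_xi !bsum_eta !bsum_xi_eta_sqr -/M => off.
have := bsum2_dist n s0; have := bsum2_dist n s1.
have := bsum_eta_sqr n s0; have := bsum_xi_eta n s0; have := bsum_xi_eta n s1.
move: off; rewrite -/M -/s0 -/s1.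
set R2 := bsum2 n _; set U1 := bsum2 n _; set U0 := bsum2 n _.
set E := bsum n _; set B0 := bsum n _; set B1 := bsum n _.
move=> hR hB1 hB0 hE hU1 hU0.
have -> : 9 * (2 * U0 + 2 * U1 + (R2 + R2)) = 18 * U0 + 18 * U1 + 9 * (2 * R2) by ring.
rewrite hU0 hU1 hR.
have -> : 9 * (2 * M * (4 * E + 4 * e * 0 + 4 * (M * M ^+ 2)) + 4 * 0
  + 4 * e * B0 + 4 * M ^+ 2 * 0 - (4 * 0 + - (4 * e) * B1 + 4 * M ^+ 2 * 0)) =
  24 * M * (3 * E) + 72 * M ^+ 4 + 18 * e * (2 * B0) + 18 * e * (2 * B1).
  by ring.
by rewrite hE hB0 hB1; ring.
Qed.

(** * Evaluation of the two sums in Warnock's formula *)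

Let K : int := 2 ^+ n.+1.

(* The two sums of Warnock's formula cleared of denominators, with the sign of
   [eta] already summed over. *)
Definition warnock_pair :=
  bsum2 n.+1 (fun t u => (2 * (2 ^+ n.+1 + 1) + xi t + xi u - `|xi t - xi u|) *
    (4 * (2 ^+ n.+1 + 1) - sym_dist a sg t u)).

Definition warnock_single :=
  bsum n.+1 (fun t => (4 * 2 ^+ n.+1 ^+ 2 - (2 ^+ n.+1 - 1 - xi t) ^+ 2) *
    (4 * 2 ^+ n.+1 ^+ 2 - (2 ^+ n.+1 - 1) ^+ 2 - full_eta a sg t ^+ 2)).

(** After expansion the terms linear in [xi] vanish, and [bsum_sym_dist] reduces all pair sums to
    single ones except those containing the [xi] distance. *)
Lemma warnock_pairE :
  9 * warnock_pair = 72 * (K + 1) ^+ 2 * K ^+ 2 - 12 * (K + 1) * (2 * K * (K ^+ 2 - 1))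
   - 24 * (K + 1) * (K ^+ 3 - K)
   - 18 * (2 * e * M ^+ 2 * (bias s0 n - bias s1 n))
   + (9 * M ^+ 2 * (bias s0 n ^+ 2 + bias s1 n ^+ 2)
  + 18 * M ^+ 2 * e * (bias s0 n + bias s1 n)
  + 128 * M ^+ 4 - (6 * n%:Z + 56) * M ^+ 2).
Proof.
rewrite /warnock_pair -/K.
rewrite (@eq_bsum2 _ _ (fun t u => 8 * (K + 1) ^+ 2 + 4 * (K + 1) * xi t + 4 * (K + 1) * xi u
  - 4 * (K + 1) * `|xi t - xi u| - 2 * (K + 1) * sym_dist a sg t u
  - xi t * sym_dist a sg t u - xi u * sym_dist a sg t u
  + `|xi t - xi u| * sym_dist a sg t u)); last by move=> *; ring.
rewrite !(bsum2D, bsum2N, bsum2Z, bsum2_cst) -/K.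
have x1 : bsum2 n.+1 (fun t u => xi t) = 0.
  rewrite /bsum2 -[RHS](mulr0 (2 ^+ n.+1)) -(bsum_xi n.+1) -bsumZ.
  by apply: eq_bsum => t _; rewrite bsum_cst.
have x2 : bsum2 n.+1 (fun t u => xi u) = 0.
  by rewrite /bsum2 bsum_xi bsum_cst mulr0.
have p1 : bsum2 n.+1 (fun t u => `|full_eta a sg t - full_eta a sg u|)
  + bsum2 n.+1 (fun t u => `|full_eta a sg t + full_eta a sg u|) =
  bsum n.+1 (fun t => full_eta a sg t ^+ 2) + K * (K ^+ 2 - 1).
  rewrite -bsum2D -(bsum_cst n.+1) -bsumD; apply: eq_bsum => t st.
  by rewrite bsum_sym_dist // addrA.
have p2 : bsum2 n.+1 (fun t u => xi t * sym_dist a sg t u) =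
  bsum n.+1 (fun t => xi t * full_eta a sg t ^+ 2).
  rewrite -[RHS]addr0 -[X in _ + X](mulr0 (K ^+ 2 - 1)) -(bsum_xi n.+1).
  rewrite -bsumZ -bsumD; apply: eq_bsum => t st.
  by rewrite bsumZ bsum_sym_dist // -/K; ring.
have p3 : bsum2 n.+1 (fun t u => xi u * sym_dist a sg t u) =
  bsum n.+1 (fun t => xi t * full_eta a sg t ^+ 2).
  rewrite -p2 /bsum2 bsum_exchange; apply: eq_bsum => t _; apply: eq_bsum => u _.
  by rewrite sym_distC.
have := bsum2_xi_sym_dist; have := bsum_full_eta_sqr; have := bsum2_xi_dist n.+1.
rewrite x1 x2 p1 p2 p3 bsum_xi_full_eta_sqr -/K.
move=> hD hE hF; rewrite -hF -hD; move: hE.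
move: (bsum n.+1 _) => E hE.
have -> : 24 * (K + 1) * (K ^+ 3 - K) = 6 * (K + 1) * (3 * E) + 18 * (K + 1) * (K ^+ 3 - K).
  by rewrite hE; ring.
ring.
Qed.

Lemma warnock_singleE : let A := 4 * K ^+ 2 - (K - 1) ^+ 2 in
  9 * warnock_single = 9 * K * A ^+ 2 - 6 * A * (K ^+ 3 - K)
  - 18 * (K - 1) * (2 * e * M ^+ 2 * (bias s0 n - bias s1 n))
  + (18 * M ^+ 3 * (bias s0 n ^+ 2 + bias s1 n ^+ 2)
  + 36 * M ^+ 3 * e * (bias s0 n + bias s1 n)
  + 32 * M ^+ 5 - (36 * n%:Z + 16) * M ^+ 3 + 2 * M).
Proof.
move=> A; rewrite /warnock_single -/K.
rewrite (@eq_bsum _ _ (fun t => A ^+ 2 + 2 * A * (K - 1) * xi t - A * xi t ^+ 2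
  - A * full_eta a sg t ^+ 2 - 2 * (K - 1) * (xi t * full_eta a sg t ^+ 2)
  + xi t ^+ 2 * full_eta a sg t ^+ 2)); last by move=> *; rewrite /A; ring.
rewrite !(bsumD, bsumN, bsumZ, bsum_cst) -/K bsum_xi bsum_xi_full_eta_sqr.
have := bsum_xi_sqr n.+1; have := bsum_full_eta_sqr; have := bsum_xi_sqr_full_eta_sqr.
set Q := bsum n.+1 _; set E := bsum n.+1 _; set E' := bsum n.+1 _.
move=> <- hE hE'; have -> : E' = E by lia.
by rewrite -/K in hE; rewrite -hE; ring.
Qed.

(** The left side is Warnock's expression for [2 * K] points times [144 * K^3]. Since [K = 2 * M],
    the sums and the squares of the biases have equal weights in both parts and cancel; of the
    differences only the part without the factor [K] survives. *)
Lemma warnock_identity :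
  18 * K * warnock_pair - 18 * warnock_single + 64 * K ^+ 5 =
  6 * n.+1%:Z * K ^+ 3 + 198 * K ^+ 3 + 144 * K ^+ 2 - 8 * K
  - 18 * K ^+ 2 * e * (bias s0 n - bias s1 n).
Proof.
have -> : 18 * K * warnock_pair - 18 * warnock_single =
  2 * K * (9 * warnock_pair) - 2 * (9 * warnock_single) by ring.
by rewrite warnock_pairE warnock_singleE /K pow2S -/M intS; ring.
Qed.
End Full.

(** * Warnock's formula *)

(** Integrability and value travel together, so that linearity applies without separate side
    conditions. *)
Definition has_integral (d : measure_display) (T : measurableType d) (R : realType)
    (mu : {measure set T -> \bar R}) (f : T -> R) (v : R) :=
  mu.-integrable setT (EFin \o f) /\ (\int[mu]_x (f x)%:E = v%:E)%E.

Section HasIntegral.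
Context (d : measure_display) (T : measurableType d) (R : realType).
Variable mu : {measure set T -> \bar R}.
Implicit Types (f g : T -> R) (u v : R).

Lemma has_integralD f g u v : has_integral mu f u -> has_integral mu g v ->
  has_integral mu (fun x => f x + g x) (u + v).
Proof.
move=> [fi fu] [gi gv]; split; first exact: (integrableD measurableT fi gi).
under eq_integral do rewrite EFinD.
by rewrite integralD// fu gv.
Qed.

Lemma has_integralZ f u c : has_integral mu f u ->
  has_integral mu (fun x => c * f x) (c * u).
Proof.
move=> [fi fu]; split; first exact: (integrableZl measurableT c fi).
under eq_integral do rewrite EFinM.
by rewrite integralZl// fu.
Qed.

Lemma has_integral0 : has_integral mu (fun=> 0) 0.
Proof. by split; [exact: integrable0 | rewrite integral0]. Qed.

Lemma has_integral_sum (I : eqType) (r : seq I) (F : I -> T -> R) (V : I -> R) :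
  (forall i, i \in r -> has_integral mu (F i) (V i)) ->
  has_integral mu (fun x => \sum_(i <- r) F i x) (\sum_(i <- r) V i).
Proof.
elim: r => [|i r IH] h.
  rewrite big_nil; under eq_fun do rewrite big_nil.
  exact: has_integral0.
rewrite big_cons; under eq_fun do rewrite big_cons.
apply: has_integralD; first by apply: h; rewrite mem_head.
by apply: IH => j jr; apply: h; rewrite in_cons jr orbT.
Qed.

End HasIntegral.

(** As a function of the corner [t] of the box, exponent 0 tests whether a point lies in it,
    exponent 1 also carries the factor [t] of the volume, and exponent 2 with [x = 0] gives the
    squared volume. *)
Definition cutpow (R : realType) k (x t : R) : R := t ^+ k * \1_(`]x, 1]) t.

Section ProductIntegral.
Context (R : realType).
Notation mu := (@lebesgue_measure R).

Lemma has_integral_prod (f g : R -> R) (u v : R) :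
  measurable_fun setT f -> measurable_fun setT g ->
  (forall x, 0 <= f x) -> (forall x, 0 <= g x) ->
  (\int[mu]_x (f x)%:E = u%:E)%E -> (\int[mu]_x (g x)%:E = v%:E)%E ->
  has_integral (mu \x mu)%E (fun z => f z.1 * g z.2) (u * v).
Proof.
move=> mf mg f0 g0 fu gv.
have mfg : measurable_fun setT (fun z : R * R => f z.1 * g z.2).
  by apply: measurable_funM; apply: measurableT_comp.
have v0 : 0 <= v by rewrite -lee_fin -gv; apply: integral_ge0 => x _; rewrite lee_fin.
have E : (\int[mu \x mu]_z (f z.1 * g z.2)%:E = (u * v)%:E)%E.
  rewrite fubini_tonelli1 /fubini_F /=; last 2 first.
  - exact/measurable_EFinP.
  - by move=> z; rewrite lee_fin mulr_ge0.
  transitivity (\int[mu]_x (v%:E * (f x)%:E))%E.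
    apply: eq_integral => x _; rewrite muleC.
    under eq_integral do rewrite EFinM.
    rewrite ge0_integralZl ?gv//.
    - exact/measurable_EFinP.
    - by move=> y _; rewrite lee_fin.
    - by rewrite lee_fin.
  rewrite ge0_integralZl ?fu//.
  - by rewrite -EFinM mulrC.
  - exact/measurable_EFinP.
  - by move=> y _; rewrite lee_fin.
split=> //; apply/integrableP; split; first exact/measurable_EFinP.
under eq_integral do rewrite /= ger0_norm ?mulr_ge0//.
by rewrite E ltry.
Qed.

Lemma measurable_cutpow k (x : R) : measurable_fun setT (cutpow k x).
Proof.
apply: measurable_funM; first exact: exprn_measurable.
exact: measurable_indic.
Qed.

Lemma cutpow_ge0 k (x t : R) : 0 <= x -> 0 <= cutpow k x t.
Proof.
move=> x0; rewrite /cutpow indicE; case: (boolP (t \in _)) => [|_]; last by rewrite mulr0.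
rewrite inE /= in_itv /= => /andP[xt _].
by rewrite mulr1 exprn_ge0// (le_trans x0)// ltW.
Qed.

Lemma integral_cutpow k (x : R) : 0 <= x < 1 ->
  (\int[mu]_t (cutpow k x t)%:E = ((1 - x ^+ k.+1) / k.+1%:R)%:E)%E.
Proof.
move=> /andP[x0 x1].
transitivity (\int[mu]_(t in `]x, 1%R]) (t ^+ k)%:E)%E.
  rewrite [RHS]integral_mkcond; apply: eq_integral => t _.
  rewrite /cutpow patchE indicE; case: ifP => _; by rewrite ?mulr1 ?mulr0.
rewrite integral_itv_obnd_cbnd; last first.
  by apply/measurable_EFinP; apply: measurable_funTS; exact: exprn_measurable.
rewrite (@continuous_FTC2 _ _ (fun t => t ^+ k.+1 / k.+1%:R))//=.
- by rewrite expr1n -EFinB mulrBl.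
- by apply: continuous_subspaceT => t; exact: exprn_continuous.
- split.
  + by move=> y _; apply: derivableM => //; exact: exprn_derivable.
  + apply: cvg_at_right_filter; apply: cvgM; last exact: cvg_cst.
    exact: exprn_continuous.
  + apply: cvg_at_left_filter; apply: cvgM; last exact: cvg_cst.
    exact: exprn_continuous.
- move=> y _; rewrite derive1Mr//; last exact: exprn_derivable.
  by rewrite derive1E exp_derive scaler1 mulrAC divff// mul1r.
Qed.

Lemma has_integral_cutpow k (x y : R) : 0 <= x < 1 -> 0 <= y < 1 ->
  has_integral (mu \x mu)%E (fun z => cutpow k x z.1 * cutpow k y z.2)
    ((1 - x ^+ k.+1) * (1 - y ^+ k.+1) / k.+1%:R ^+ 2).
Proof.
move=> x01 y01.
have -> : (1 - x ^+ k.+1) * (1 - y ^+ k.+1) / k.+1%:R ^+ 2 =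
  ((1 - x ^+ k.+1) / k.+1%:R) * ((1 - y ^+ k.+1) / k.+1%:R) by field.
apply: has_integral_prod; try exact: measurable_cutpow; try exact: integral_cutpow.
- by move=> t; apply: cutpow_ge0; case/andP: x01.
- by move=> t; apply: cutpow_ge0; case/andP: y01.
Qed.

End ProductIntegral.

Lemma cutpowE (R : realType) k (x t : R) : t <= 1 -> cutpow k x t = t ^+ k * (x < t)%R%:R.
Proof. by move=> t1; rewrite /cutpow indicE mem_setE in_itv /= t1 andbT. Qed.

Lemma cutpow_out (R : realType) k (x t : R) :
  0 <= x -> t \notin `[0, 1] -> cutpow k x t = 0.
Proof.
move=> x0; rewrite /cutpow indicE mem_setE !in_itv /=.
have [t1|t1] := leP t 1; last by rewrite !andbF mulr0.
rewrite !andbT -ltNge => t0; have -> : (x < t) = false by apply/negbTE; rewrite -leNgt; lra.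
by rewrite /= mulr0.
Qed.

Lemma card_fset_count (R : realType) (P : {fset R * R}) (p : pred (R * R)) :
  (#|` [fset z in P | p z] |)%:R = \sum_(z <- P) (p z)%:R :> R.
Proof.
rewrite card_fset_sum1 natr_sum -big_fset_condE big_mkcond /=.
by apply: eq_bigr => z _; case: (p z).
Qed.

Lemma ltr_max_natr (R : realType) (x y t : R) :
  (Num.max x y < t)%R%:R = (x < t)%R%:R * (y < t)%R%:R :> R.
Proof. by rewrite gt_max; case: (x < t); case: (y < t); rewrite ?mulr0 ?mulr1. Qed.

(** The square is expanded, and a box contains both [z] and [w] exactly if it contains their
    coordinatewise maximum. Every term is a combination of products of one-variable functions on the
    whole plane. *)
Lemma discrepancy_sqr (R : realType) (P : {fset R * R}) (t : R * R) :
  (forall z, z \in P -> 0 <= z.1 < 1 /\ 0 <= z.2 < 1) ->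
  ((fun t => ((discrepancy P t) ^+ 2)%:E) \_ (`[0%R, 1%R] `*` `[0%R, 1%R])%classic) t =
  ((#|` P |%:R ^- 2 * (\sum_(z <- P) \sum_(w <- P)
      cutpow 0 (Num.max z.1 w.1) t.1 * cutpow 0 (Num.max z.2 w.2) t.2)
   + ((- (2 / #|` P |%:R)) * (\sum_(z <- P) cutpow 1 z.1 t.1 * cutpow 1 z.2 t.2)
   + cutpow 2 0 t.1 * cutpow 2 0 t.2)))%:E.
Proof.
case: t => t1 t2 hP; rewrite patchE.
have P0 z : z \in P -> 0 <= z.1 /\ 0 <= z.2.
  by move=> /hP[/andP[? _] /andP[? _]].
(* Outside the unit square every product on the right has a vanishing factor. *)
case: ifPn => [|tD]; last first.
  suff cut0 k x y : 0 <= x -> 0 <= y -> cutpow k x t1 * cutpow k y t2 = 0.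
    rewrite big1_seq ?big1_seq ?mulr0 ?add0r.
    - by rewrite cut0.
    - by move=> z /= zP; case: (P0 z zP) => ? ?; rewrite cut0.
    - move=> z /= zP; rewrite big1_seq // => w /= wP.
      by case: (P0 z zP) => ? ?; rewrite cut0// le_max; apply/orP; left.
  move=> x0 y0; move: tD; apply: contraNeq; rewrite mulf_eq0 negb_or => /andP[h1 h2].
  rewrite inE /=; split.
    by move: h1; apply: contraNT => h1; apply/eqP/cutpow_out.
  by move: h2; apply: contraNT => h2; apply/eqP/cutpow_out.
rewrite inE /= !in_itv /= => -[/andP[t10 t11] /andP[t20 t21]]; congr (_%:E).
rewrite /discrepancy card_fset_count /=.
pose c (z : R * R) : R := (z.1 < t1)%R%:R * (z.2 < t2)%R%:R.
have -> : \sum_(z <- P) ((z.1 \in `[0, t1[) && (z.2 \in `[0, t2[))%:R = \sum_(z <- P) c z.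
  apply: eq_big_seq => z zP; case: (P0 z zP) => z1 z2.
  by rewrite !in_itv /= z1 z2 /= -mulnb natrM.
have -> : \sum_(z <- P) \sum_(w <- P) cutpow 0 (Num.max z.1 w.1) t1 *
    cutpow 0 (Num.max z.2 w.2) t2 = (\sum_(z <- P) c z) ^+ 2.
  rewrite expr2 big_distrl /=; apply: eq_bigr => z _.
  rewrite big_distrr /=; apply: eq_bigr => w _.
  by rewrite !cutpowE // !ltr_max_natr /c; ring.
have -> : \sum_(z <- P) cutpow 1 z.1 t1 * cutpow 1 z.2 t2 = (\sum_(z <- P) c z) * (t1 * t2).
  rewrite big_distrl /=; apply: eq_bigr => z _.
  by rewrite !cutpowE // /c; ring.
(* The cut at 0 excludes [x = 0], where the square vanishes anyway. *)
have sq (x : R) : x <= 1 -> 0 <= x -> cutpow 2 0 x = x ^+ 2.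
  move=> x1 x0; rewrite cutpowE //; have [_|x0'] := ltP 0 x; first by rewrite mulr1.
  have -> : x = 0 by lra.
  by rewrite expr0n /= mul0r.
rewrite !sq //; move: (\sum_(z <- P) c z) => S.
by rewrite -exprVn; move: (_^-1) => N; ring.
Qed.

(** Integrating term by term, the mixed term brings [1 / 2^2] and the squared volume [1 / 3^2];
    scaling by the squared cardinality gives the factors [#|P| / 2] and [#|P|^2 / 9]. *)
Lemma warnock (R : realType) (P : {fset R * R}) :
  (forall z, z \in P -> 0 <= z.1 < 1 /\ 0 <= z.2 < 1) -> (0 < #|` P |)%N ->
  (#|` P |%:R * L2_discrepancy P) ^+ 2 =
  \sum_(z <- P) \sum_(w <- P) (1 - Num.max z.1 w.1) * (1 - Num.max z.2 w.2)
  - #|` P |%:R / 2 * (\sum_(z <- P) (1 - z.1 ^+ 2) * (1 - z.2 ^+ 2))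
  + #|` P |%:R ^+ 2 / 9.
Proof.
move=> hP P0; rewrite /L2_discrepancy exprMn sqr_sqrtr; last first.
  by apply: Rintegral_ge0 => t _; rewrite sqr_ge0.
rewrite /Rintegral integral_mkcond.
under eq_integral do rewrite discrepancy_sqr //.
have mx (x y : R) : 0 <= x < 1 -> 0 <= y < 1 -> 0 <= Num.max x y < 1.
  by rewrite le_max gt_max => /andP[-> ->] /andP[_ ->].
have h1 : has_integral (lebesgue_measure \x lebesgue_measure)%E
   (fun t : R * R => \sum_(z <- P) \sum_(w <- P)
      cutpow 0 (Num.max z.1 w.1) t.1 * cutpow 0 (Num.max z.2 w.2) t.2)
   (\sum_(z <- P) \sum_(w <- P)
      (1 - Num.max z.1 w.1 ^+ 1) * (1 - Num.max z.2 w.2 ^+ 1) / 1%:R ^+ 2).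
  apply: has_integral_sum => z /hP[z1 z2]; apply: has_integral_sum => w /hP[w1 w2].
  by apply: has_integral_cutpow; exact: mx.
have h2 : has_integral (lebesgue_measure \x lebesgue_measure)%E
   (fun t : R * R => \sum_(z <- P) cutpow 1 z.1 t.1 * cutpow 1 z.2 t.2)
   (\sum_(z <- P) (1 - z.1 ^+ 2) * (1 - z.2 ^+ 2) / 2%:R ^+ 2).
  by apply: has_integral_sum => z /hP[z1 z2]; exact: has_integral_cutpow.
have h3 : has_integral (lebesgue_measure \x lebesgue_measure)%E
   (fun t : R * R => cutpow 2 0 t.1 * cutpow 2 0 t.2)
   ((1 - 0 ^+ 3) * (1 - 0 ^+ 3) / 3%:R ^+ 2).
  by apply: has_integral_cutpow; rewrite lexx ltr01.
have [_ ->] := has_integralD (has_integralZ (#|` P |%:R ^- 2) h1)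
  (has_integralD (has_integralZ (- (2 / #|` P |%:R)) h2) h3).
rewrite /= -big_distrl /= expr0n /=.
have -> : \sum_(z <- P) \sum_(w <- P)
    (1 - Num.max z.1 w.1 ^+ 1) * (1 - Num.max z.2 w.2 ^+ 1) / 1%:R ^+ 2 =
  \sum_(z <- P) \sum_(w <- P) (1 - Num.max z.1 w.1) * (1 - Num.max z.2 w.2).
  by apply: eq_bigr => z _; apply: eq_bigr => w _; field.
have : #|` P |%:R != 0 :> R by rewrite pnatr_eq0 -lt0n.
move: (#|` P |%:R : R) => N N0.
move: (\sum_(z <- P) _) => S1; move: (\sum_(z <- P) _) => S2.
by field.
Qed.

(** * The symmetrised point set *)

(* A coordinate with binary digits [d_1 ... d_n] in terms of its signed sum [z]
   of the [2^(n-k) (-1)^(d_k)], since [d = (1 - (-1)^d) / 2]. *)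
Definition embed (R : realType) n (z : int) : R :=
  (2 ^+ n - 1 - z%:~R) / (2 * 2 ^+ n).

Lemma natr_chi (R : realType) (b : bool) : b%:R = (1 - (chi b)%:~R) / 2 :> R.
Proof. by case: b; rewrite /chi /= ?expr1 ?expr0 ?rmorphN ?rmorph1 /=; lra. Qed.

Lemma sum_pow2 (R : realType) n : \sum_(i < n) 2 ^+ i = 2 ^+ n - 1 :> R.
Proof.
elim: n => [|n IH]; first by rewrite big_ord0 subrr.
by rewrite big_ord_recr /= IH exprS; ring.
Qed.

(** Only the total of the weights matters, so the same statement serves the increasing weights of
    the first coordinate and the decreasing ones of the second. *)
Lemma sum_digits (R : realType) n (d : nat -> bool) (w : nat -> nat) :
  \sum_(i < n) 2 ^+ w i = 2 ^+ n - 1 :> R ->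
  \sum_(i < n) (d i)%:R * 2 ^+ w i / 2 ^+ n =
  embed R n (\sum_(i < n) 2 ^+ w i * chi (d i)).
Proof.
move=> sw; rewrite /embed -sw rmorph_sum /= -sumrB mulr_suml; apply: eq_bigr => i _.
rewrite natr_chi rmorphM rmorphXn /=.
by field; rewrite expf_neq0.
Qed.

Lemma pt1E (R : realType) n (a : n.-1.-tuple bool) (sigma t : n.-tuple bool) :
  (pt R a sigma t).1 = embed R n (xi t).
Proof.
rewrite /= big_add1 big_mkord /= /xi size_tuple.
rewrite -(@sum_digits _ _ (nth false t) id) ?sum_pow2 //.
apply: eq_bigr => i _; rewrite /bit /= subSS -mulrA; congr (_ * _).
rewrite -[in X in _ / X](subnKC (ltnW (ltn_ord i))) exprD.
by field; rewrite !expf_neq0.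
Qed.

(** The two cases of [ybit] merge because reading [a] past its end gives [false]. *)
Lemma ybitE n (a : n.-tuple bool) (sigma t : n.+1.-tuple bool) i : (i < n.+1)%N ->
  @ybit n.+1 a sigma t i.+1 =
  nth false t i (+) digit_shift (nth false a) (nth false sigma) (last false t) i.
Proof.
rewrite ltnS leq_eqVlt => /orP[/eqP ->|ilt]; rewrite /ybit /digit_shift /bit /=.
  by rewrite ltnn [nth false a n]nth_default ?size_tuple.
rewrite ltnS ilt addbA; congr (_ (+) (_ && _) (+) _).
by rewrite (last_nth false) size_tuple /=; case: (tval t) (size_tuple t).
Qed.

Lemma pt2E (R : realType) n (a : n.-tuple bool) (sigma t : n.+1.-tuple bool) :
  (pt R (n := n.+1) a sigma t).2 =
  embed R n.+1 (full_eta (nth false a) (nth false sigma) t).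
Proof.
rewrite /= big_add1 big_mkord /= /full_eta /eta size_tuple.
rewrite -(@sum_digits _ _ (fun i => nth false t i (+)
     digit_shift (nth false a) (nth false sigma) (last false t) i)
   (fun i => n.+1 - i.+1)%N); last first.
  rewrite -sum_pow2 (reindex_inj rev_ord_inj) /=; apply: eq_bigr => i _.
  by congr (_ ^+ _); have := ltn_ord i; lia.
apply: eq_bigr => i _; rewrite ybitE //= -mulrA; congr (_ * _).
rewrite -[in X in _ / X](subnKC (ltn_ord i)) exprD.
by field; rewrite !expf_neq0.
Qed.

Lemma full_eta_star n (a : nat -> bool) (sigma t : n.-tuple bool) :
  full_eta a (nth false (star sigma)) t = - full_eta a (nth false sigma) t.
Proof.
rewrite /full_eta /eta -sumrN; apply: eq_bigr => i _.
rewrite /digit_shift /= (nth_map false); last first.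
  by rewrite (leq_trans (ltn_ord i)) ?size_tuple.
by rewrite -mulrN -chi_negb !addbN.
Qed.

(* The index [(c, t)] is the point of parameter [t] with shift sigma if
   [c = false], and sigma* if [c = true]. *)
Definition sym_point (R : realType) n (a : n.-tuple bool) (sigma : n.+1.-tuple bool)
    (i : bool * n.+1.-tuple bool) : R * R :=
  (embed R n.+1 (xi i.2),
   embed R n.+1 (chi i.1 * full_eta (nth false a) (nth false sigma) i.2)).

Lemma embed_inj (R : realType) n : injective (embed R n).
Proof.
move=> z w /(congr1 (fun x => x * (2 * 2 ^+ n))).
rewrite /embed !divfK ?mulf_neq0 ?expf_neq0 //.
by move/addrI/oppr_inj => /intr_inj.
Qed.

(** [full_eta] is odd, hence nonzero, so the points for sigma and sigma* with the same [t] differ;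
    the union is therefore disjoint. *)
Lemma sym_point_inj (R : realType) n (a : n.-tuple bool) (sigma : n.+1.-tuple bool) :
  injective (sym_point R a sigma).
Proof.
move=> [c t] [d u] [] /embed_inj/xi_inj; rewrite !size_tuple.
move=> /(_ erefl)/val_inj -> {t} /embed_inj.
have [q] := full_eta_odd (nth false a) (nth false sigma) (size_tuple u).
move: (full_eta _ _ _) => y yq.
by case: c; case: d => //; rewrite /chi /= yq; lia.
Qed.

Lemma sym_point_setE (R : realType) n (a : n.-tuple bool) (sigma : n.+1.-tuple bool) :
  sym_point_set R (n := n.+1) a sigma =
  [fset sym_point R a sigma i | i in {: bool * n.+1.-tuple bool}].
Proof.
have g0 t : pt R (n := n.+1) a sigma t = sym_point R a sigma (false, t).
  by rewrite [LHS]surjective_pairing pt1E pt2E /sym_point /= mul1r.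
have g1 t : pt R (n := n.+1) a (star sigma) t = sym_point R a sigma (true, t).
  by rewrite [LHS]surjective_pairing pt1E pt2E full_eta_star /sym_point /= mulN1r.
apply/fsetP => z; rewrite !inE; apply/orP/imfsetP => /=.
  move=> [|] /imfsetP[t _ ->]; first by exists (false, t); rewrite // g0.
  by exists (true, t); rewrite // g1.
move=> [[[] t] _ ->]; [right | left]; apply/imfsetP; exists t;
  by rewrite ?g0 ?g1.
Qed.

Lemma embed_bound (R : realType) n z : - (2 ^+ n) < z < 2 ^+ n -> 0 <= embed R n z < 1.
Proof.
move=> zK; have K0 : 0 < 2 ^+ n :> R by rewrite exprn_gt0.
have h1 : - (2 ^+ n) + 1 <= z by lia.
have h2 : z <= 2 ^+ n - 1 by lia.
move: h1 h2; rewrite -!(ler_int R) !(rmorphB, rmorphD, rmorphN, rmorphXn) /= => h1 h2.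
by rewrite /embed divr_ge0 ?ltr_pdivrMr ?mulr_gt0 //=; lra.
Qed.

(** [embed] is decreasing, so the maximum belongs to the smaller of [z] and [w], and twice that is
    [z + w - |z - w|]. *)
Lemma onem_max_embed (R : realType) n (z w : int) :
  1 - Num.max (embed R n z) (embed R n w) =
  (2 * (2 ^+ n + 1) + z + w - `|z - w|)%:~R / (4 * 2 ^+ n).
Proof.
have K0 : 0 < 2 ^+ n :> R by rewrite exprn_gt0.
have le_embed u v : (embed R n u <= embed R n v) = (v <= u).
  by rewrite ler_pM2r ?invr_gt0 ?mulr_gt0 // lerD2l lerN2 ler_int.
rewrite !(rmorphB, rmorphD, rmorphM, rmorphXn) /=.
have [zw|zw] := leP w z.
  rewrite max_r ?le_embed // ger0_norm ?subr_ge0 // rmorphB /= /embed.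
  by field; rewrite gt_eqF.
rewrite max_l ?le_embed ?(ltW zw) //.
rewrite ltr0_norm ?subr_lt0 // rmorphN rmorphB /= /embed.
by field; rewrite gt_eqF.
Qed.

Lemma onem_sqr_embed (R : realType) n (z : int) :
  1 - embed R n z ^+ 2 =
  (4 * 2 ^+ n ^+ 2 - (2 ^+ n - 1 - z) ^+ 2)%:~R / (4 * 2 ^+ n ^+ 2).
Proof.
rewrite !(rmorphB, rmorphD, rmorphM, rmorphXn) /= /embed.
by field; rewrite expf_neq0.
Qed.

Lemma big_sym_point_set (R : realType) (V : nmodType) n (a : n.-tuple bool)
    (sigma : n.+1.-tuple bool) (G : R * R -> V) :
  \sum_(z <- sym_point_set R (n := n.+1) a sigma) G z =
  \sum_(t : n.+1.-tuple bool)
    (G (sym_point R a sigma (false, t)) + G (sym_point R a sigma (true, t))).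
Proof.
rewrite sym_point_setE big_imfset /=; last by move=> ? ? _ _; exact: sym_point_inj.
transitivity (\sum_(i : bool * n.+1.-tuple bool) G (sym_point R a sigma i)).
  by rewrite -[RHS]big_enum.
rewrite -(pair_bigA _ (fun c t => G (sym_point R a sigma (c, t)))) /= big_bool /= addrC.
by rewrite -big_split.
Qed.

Lemma card_sym_point_set (R : realType) n (a : n.-tuple bool) (sigma : n.+1.-tuple bool) :
  #|` sym_point_set R (n := n.+1) a sigma | = (2 ^ n.+2)%N.
Proof.
rewrite card_fset_sum1 big_sym_point_set sum_nat_const card_tuple card_bool.
by rewrite [RHS]expnSr.
Qed.

Lemma sym_point_set_bound (R : realType) n (a : n.-tuple bool) (sigma : n.+1.-tuple bool) z :
  z \in sym_point_set R (n := n.+1) a sigma -> 0 <= z.1 < 1 /\ 0 <= z.2 < 1.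
Proof.
rewrite sym_point_setE => /imfsetP[[c t] _ ->]; split; apply: embed_bound.
  by have := xi_bound t; rewrite size_tuple.
have := full_eta_bound (nth false a) (nth false sigma) t; rewrite size_tuple /=.
by case: (chiP c) => ->; lia.
Qed.

(** * The exact formula *)

Section Assembly.
Variables (R : realType) (n : nat) (a : n.-tuple bool) (sigma : n.+1.-tuple bool).
Let P := sym_point_set R (n := n.+1) a sigma.
Let av := nth false a.
Let sv := nth false sigma.
Let K : R := 2 ^+ n.+1.

(** Over the four choices of signs the terms linear in [full_eta] cancel and each of the two
    distances in [sym_dist] occurs twice, whence the factor 2. *)
Lemma sum_pair_sym_point_set :
  \sum_(z <- P) \sum_(w <- P) (1 - Num.max z.1 w.1) * (1 - Num.max z.2 w.2) =
  2 * (warnock_pair n av sv)%:~R / (4 * K) ^+ 2.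
Proof.
have -> : 2 * (warnock_pair n av sv)%:~R / (4 * K) ^+ 2 =
  (2 * warnock_pair n av sv)%:~R / (4 * K) ^+ 2 by rewrite rmorphM.
rewrite /warnock_pair -bsum2Z /bsum2 /bsum rmorph_sum /= mulr_suml.
rewrite big_sym_point_set; apply: eq_bigr => t _.
rewrite !big_sym_point_set -big_split /= rmorph_sum /= mulr_suml; apply: eq_bigr => u _.
rewrite !onem_max_embed -/K /sym_dist /=.
rewrite !mulf_div -!mulrDl -!rmorphM -!rmorphD /= expr2; congr (_%:~R / _).
move: (full_eta _ _ _) (full_eta _ _ _) => y y'.
rewrite -!mulrDr [RHS]mulrCA; congr (_ * _).
by rewrite /chi /= !expr0 !expr1 !mulN1r !mul1r; lia.
Qed.

Lemma sum_single_sym_point_set :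
  \sum_(z <- P) (1 - z.1 ^+ 2) * (1 - z.2 ^+ 2) =
  2 * (warnock_single n av sv)%:~R / (4 * K ^+ 2) ^+ 2.
Proof.
have -> : 2 * (warnock_single n av sv)%:~R / (4 * K ^+ 2) ^+ 2 =
  (2 * warnock_single n av sv)%:~R / (4 * K ^+ 2) ^+ 2 by rewrite rmorphM.
rewrite /warnock_single -bsumZ /bsum rmorph_sum /= mulr_suml.
rewrite big_sym_point_set; apply: eq_bigr => t _.
rewrite !onem_sqr_embed -/K /=.
rewrite !mulf_div -!mulrDl -!rmorphM -!rmorphD /= expr2; congr (_%:~R / _).
by rewrite /chi /= !expr0 !expr1 !mulN1r !mul1r; ring.
Qed.

(** Positions with [a_i = 0] have the same shift for both last digits and cancel; the others have
    opposite signs and count twice. *)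
Lemma bias_Lsum :
  (bias (digit_shift av sv false) n - bias (digit_shift av sv true) n)%:~R =
  2 * Lsum R (n := n.+1) a sigma.
Proof.
rewrite /bias /Lsum -sumrB rmorph_sum /= big_add1 /= big_mkord mulr_sumr.
apply: eq_bigr => i _; rewrite /digit_shift /bit /= -/(av i) -/(sv i).
by case: (av i); case: (sv i); rewrite /chi /= ?expr0 ?expr1 ?rmorphB ?rmorphN ?rmorph1 /=; ring.
Qed.

Lemma L2_sym_point_set :
  (2 ^+ n.+2 * L2_discrepancy P) ^+ 2 =
  n.+1%:R / 24 + 11 / 8 + 1 / 2 ^+ n.+1 - 1 / (9 * 2 ^+ (2 * n.+1 + 1))
   - (-1) ^+ (bit sigma n.+1) / 2 ^+ (n.+1 + 2) * Lsum R (n := n.+1) a sigma.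
Proof.
have cP := card_sym_point_set R a sigma.
have P0 : (0 < #|` P|)%N by rewrite cP expn_gt0.
have := warnock (@sym_point_set_bound R n a sigma) P0.
rewrite cP natrX => ->; rewrite sum_pair_sym_point_set sum_single_sym_point_set.
have an : av n = false by rewrite /av nth_default ?size_tuple.
have KE : K = (2 ^+ n.+1 : int)%:~R by rewrite rmorphXn.
(* [warnock_identity] is moved to [R], with the difference of the biases replaced by twice
   [Lsum]. *)
have id : 18 * K * (warnock_pair n av sv)%:~R
    - 18 * (warnock_single n av sv)%:~R + 64 * K ^+ 5 =
    6 * n.+1%:R * K ^+ 3 + 198 * K ^+ 3 + 144 * K ^+ 2 - 8 * K
    - 36 * K ^+ 2 * (-1) ^+ sv n * Lsum R (n := n.+1) a sigma.
  have -> : (-1) ^+ sv n = (chi (sv n))%:~R :> R by rewrite /chi rmorphXn rmorphN rmorph1.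
  transitivity ((18 * 2 ^+ n.+1 * warnock_pair n av sv - 18 * warnock_single n av sv
     + 64 * 2 ^+ n.+1 ^+ 5)%:~R : R).
    by rewrite KE; move: (2 ^+ n.+1 : int) => k; ring.
  have -> : forall x : R, x - 36 * K ^+ 2 * (chi (sv n))%:~R * Lsum R (n := n.+1) a sigma =
     x - 18 * K ^+ 2 * (chi (sv n))%:~R * (2 * Lsum R (n := n.+1) a sigma).
    by move=> x; ring.
  rewrite (warnock_identity sv an) -bias_Lsum KE.
  by move: (2 ^+ n.+1 : int) (bias _ _) (bias _ _) (chi _) => k b0 b1 e; ring.
rewrite /bit /= -/(sv n) -/K.
have -> : 2 ^+ n.+2 = 2 * K by rewrite exprS.
have -> : 2 ^+ (n.+1 + 2) = 4 * K by rewrite exprD -/K; ring.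
have -> : 2 ^+ (2 * n.+1 + 1) = 2 * K ^+ 2 by rewrite exprD mulnC exprM -/K; ring.
have K0 : K != 0 by rewrite expf_neq0.
move: id K0; move: ((warnock_pair n av sv)%:~R : R).
move: ((warnock_single n av sv)%:~R : R) ((-1) ^+ sv n : R).
move: (Lsum R (n := n.+1) a sigma) (n.+1%:R : R) K => L N k Y e X id k0.
have -> : X = (6 * N * k ^+ 3 + 198 * k ^+ 3 + 144 * k ^+ 2 - 8 * k
    - 36 * k ^+ 2 * e * L - 64 * k ^+ 5 + 18 * Y) / (18 * k).
  apply: (canRL (mulfK _)); first by rewrite mulf_neq0.
  by rewrite mulrC; lra.
by field.
Qed.
End Assembly.

(** * The upper bound *)

Lemma Lsum_bound (R : realType) n (a : n.-1.-tuple bool) (sigma : n.-tuple bool) :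
  `|Lsum R a sigma| <= n%:R.
Proof.
apply: (le_trans (ler_norm_sum _ _ _)); apply: (@le_trans _ _ (\sum_(1 <= i < n) (1 : R))).
  apply: ler_sum => i _; case: (bit a i); case: (bit sigma i); rewrite /=.
  - by rewrite mul1r mulr1 ler_norml; lra.
  - by rewrite mul1r mulr0 subr0 normr1.
  - by rewrite mul0r normr0.
  - by rewrite mul0r normr0.
by rewrite sumr_const_nat ler_nat leq_subr.
Qed.

(** The crude right side is a multiple of [n + 1] because [n + 1] is the logarithm of the number of
    points divided by [ln 2]. *)
Lemma L2_formula_bound (R : realType) n (a : n.-1.-tuple bool) (sigma : n.-tuple bool) :
  (1 <= n)%N ->
  n%:R / 24 + 11 / 8 + 1 / 2 ^+ n - 1 / (9 * 2 ^+ (2 * n + 1))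
   - (-1) ^+ (bit sigma n) / 2 ^+ (n + 2) * Lsum R a sigma <= 2 * n.+1%:R.
Proof.
move=> n1; rewrite -[n.+1%:R]natr1.
have n1R : 1 <= n%:R :> R by rewrite ler1n.
have K1 : 1 <= 2 ^+ n :> R by rewrite exprn_ege1 // ler1n.
have K2 : 0 <= 1 / (9 * 2 ^+ (2 * n + 1)) :> R by rewrite divr_ge0 ?mulr_ge0 ?exprn_ge0.
have K3 : 1 / 2 ^+ n <= 1 :> R by rewrite ler_pdivrMr ?mul1r ?(lt_le_trans ltr01).
have : `|(-1) ^+ (bit sigma n) / 2 ^+ (n + 2) * Lsum R a sigma| <= n%:R / 4.
  rewrite normrM normrM normrX normrN1 expr1n mul1r normfV.
  rewrite (@ger0_norm _ (2 ^+ _)) ?exprn_ge0 // [X in X <= _]mulrC.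
  apply: ler_pM; rewrite ?invr_ge0 ?exprn_ge0 ?Lsum_bound //.
  rewrite lef_pV2 ?posrE ?exprn_gt0 // addn2 !exprS; lra.
rewrite ler_norml => /andP[h _].
lra.
Qed.

Theorem theorem2 (R : realType) :
  (forall (n : nat) (a : n.-1.-tuple bool) (sigma : n.-tuple bool),
     (1 <= n)%N ->
     #|` sym_point_set R a sigma | = (2 ^ n.+1)%N /\
     (2 ^+ n.+1 * L2_discrepancy (sym_point_set R a sigma)) ^+ 2 =
       n%:R / 24 + 11 / 8 + 1 / 2 ^+ n - 1 / (9 * 2 ^+ (2 * n + 1))
       - (-1) ^+ (bit sigma n) / 2 ^+ (n + 2) * Lsum R a sigma) /\
  (exists C : R, 0 < C /\
     forall (n : nat) (a : n.-1.-tuple bool) (sigma : n.-tuple bool),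
       (1 <= n)%N ->
       L2_discrepancy (sym_point_set R a sigma) <=
         C * Num.sqrt (ln (2 ^+ n.+1)) / 2 ^+ n.+1).
Proof.
have formula (n : nat) (a : n.-1.-tuple bool) (sigma : n.-tuple bool) :
     (1 <= n)%N ->
     #|` sym_point_set R a sigma | = (2 ^ n.+1)%N /\
     (2 ^+ n.+1 * L2_discrepancy (sym_point_set R a sigma)) ^+ 2 =
       n%:R / 24 + 11 / 8 + 1 / 2 ^+ n - 1 / (9 * 2 ^+ (2 * n + 1))
       - (-1) ^+ (bit sigma n) / 2 ^+ (n + 2) * Lsum R a sigma.
  case: n a sigma => // n a sigma _; split; first exact: card_sym_point_set.
  exact: L2_sym_point_set.
split=> //.
have ln2 : 0 < ln 2 :> R by rewrite ln_gt0 // ltr1n.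
(* The square of this constant times [ln (2 ^+ n.+1)] is exactly [2 * n.+1%:R]. *)
exists (Num.sqrt (2 / ln 2)); split; first by rewrite sqrtr_gt0 divr_gt0.
move=> n a sigma n1; have [_ eL] := formula n a sigma n1.
have K0 : 0 < 2 ^+ n.+1 :> R by rewrite exprn_gt0.
rewrite ler_pdivlMr // mulrC -sqrtrM ?divr_ge0 ?(ltW ln2) //.
have L0 : 0 <= 2 ^+ n.+1 * L2_discrepancy (sym_point_set R a sigma).
  by rewrite mulr_ge0 ?(ltW K0) ?sqrtr_ge0.
rewrite -(ger0_norm L0) -sqrtr_sqr ler_wsqrtr // eL.
rewrite lnXn // -[ln 2 *+ _]mulr_natr mulrA divfK ?gt_eqF //.
exact: L2_formula_bound.
Qed.
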